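(* Let $(\mathbb{X},\mathcal{X},\mu)$ be a probability space, let $\lambda\in[2,\infty)$, and let $\tilde M$ be the manifold of finite measures on $\mathcal{X}$ defined in the context. For any $\alpha\in[-1,1]$, and any integers $0\le i,j\le\lfloor\lambda\rfloor-1$ with $i+j\le\lceil\lambda\rceil-1$, the $\alpha$-divergence $\mathcal{D}_\alpha:\tilde M\times\tilde M\to[0,\infty)$ is of class $C^{i,j}$.
   Context: $\mathbf{E}_\mu$ denotes expectation with respect to $\mu$. $\tilde M$ is the set of finite measures $P$ on $\mathcal{X}$ that are mutually absolutely continuous with respect to $\mu$ and whose density $p=dP/d\mu$ satisfies $\mathbf{E}_\mu p^\lambda<\infty$ and $\mathbf{E}_\mu|\log p|^\lambda<\infty$. $\tilde G=L^\lambda(\mu)$, and $\tilde\phi:\tilde M\to\tilde G$, $\tilde\phi(P)=p-1+\log p$, is a bijection, which is used as a single global chart making $\tilde M$ a Banach manifold modelled on $\tilde G$. For $P,Q\in\tilde M$ with densities $p,q$ with respect to $\mu$, the $\alpha$-divergence is $$\mathcal{D}_\alpha(P\mid Q)=\begin{cases} Q(\mathbb{X})-P(\mathbb{X})+\mathbf{E}_\mu\, p\log(p/q), & \alpha=-1,\\[4pt] \dfrac{2}{1+\alpha}P(\mathbb{X})+\dfrac{2}{1-\alpha}Q(\mathbb{X})-\dfrac{4}{1-\alpha^2}\mathbf{E}_\mu\, p^{(1-\alpha)/2}q^{(1+\alpha)/2}, & \alpha\in(-1,1),\\[4pt] P(\mathbb{X})-Q(\mathbb{X})+\mathbf{E}_\mu\,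 q\log(q/p), & \alpha=1.\end{cases}$$ A map on $\tilde M\times\tilde M$ is of class $C^{i,j}$ if its chart representation on $\tilde G\times\tilde G$ (here $(\tilde a,\tilde b)\mapsto\mathcal{D}_\alpha(\tilde\phi^{-1}(\tilde a)\mid\tilde\phi^{-1}(\tilde b))$) is of class $C^{i,j}$, i.e. its mixed partial Fréchet derivatives $D_1^{i'}D_2^{j'}$ ($i'$ times in the first argument, $j'$ times in the second) exist and are continuous on $\tilde G\times\tilde G$ for all $0\le i'\le i$, $0\le j'\le j$. $\lceil y\rceil$ and $\lfloor y\rfloor$ are the ceiling and floor. *)

(* Defs.v *)
From HB Require Import structures.
From mathcomp Require Import all_boot all_order all_algebra.
From mathcomp Require Import all_classical all_reals all_analysis.
From mathcomp Require Import measurable_realfun ess_sup_inf.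

Set Implicit Arguments.
Unset Strict Implicit.
Unset Printing Implicit Defensive.
Import Order.TTheory GRing.Theory Num.Theory.
Import numFieldNormedType.Exports.

Local Open Scope classical_set_scope.
Local Open Scope ring_scope.

(* [LspaceType mu p1] comes without algebraic structure; it is made a
   [normedModType R] with the L^p norm, through the class map [Lclass] from
   [LfunType mu p1] and the choice [Lrepr] of a representative. *)
Section LspaceNormedModule.
Context {d : measure_display} {T : measurableType d} {R : realType}.
Context {mu : {measure set T -> \bar R}} {p : \bar R} {p1 : (1 <= p)%E}.
Local Open Scope quotient_scope.
Implicit Types (f g : LfunType mu p1) (F G : LspaceType mu p1).

Lemma eq_Lnorm_ae (f g : T -> \bar R) (q : \bar R) : (0 < q)%E ->
  measurable_fun [set: T] f -> measurable_fun [set: T] g ->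
  f = g %[ae mu] -> ('N[mu]_q[f] = 'N[mu]_q[g])%E.
Proof.
move=> q0 mf mg fg; rewrite unlock; case: q q0 => [r r0|_|//].
- congr (_ `^ _)%E; apply: ge0_ae_eq_integral => //.
  + apply: (measurableT_comp (measurable_poweR _)) => //.
    exact: measurableT_comp.
  + apply: (measurableT_comp (measurable_poweR _)) => //.
    exact: measurableT_comp.
  + by move=> x _; exact: poweR_ge0.
  + by move=> x _; exact: poweR_ge0.
  + by apply: filterS fg => x fgx Dx; rewrite (fgx Dx).
- case: ifP => // _; apply: eq_ess_sup.
  by apply: filterS fg => x fgx; rewrite /= (fgx I).
Qed.

(* [LspaceType] is built on the Borel structure [measurableTypeR R] of [R],
   whereas [LfunType] uses the structure inferred on [R] itself: the sets are
   the same, only the displays differ. *)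
Definition mfun_measurableTypeR (f : {mfun T >-> R}) :
    {mfun T >-> measurableTypeR R} :=
  HB.pack (f : T -> measurableTypeR R)
    (@isMeasurableFun.Build _ _ T (measurableTypeR R) f
      (measurable_funPT f : @measurable_fun _ _ T (measurableTypeR R) setT f)).

Definition mfun_R (f : {mfun T >-> measurableTypeR R}) : {mfun T >-> R} :=
  HB.pack (f : T -> R) (@isMeasurableFun.Build _ _ T R f
      (measurable_funPT f : @measurable_fun _ _ T R setT f)).

Definition mfun_class (f : {mfun T >-> R}) : {mfun_ mu, T >-> measurableTypeR R} :=
  let g := mfun_measurableTypeR f in \pi g.

Lemma mfun_class_ae (f : {mfun T >-> R}) :
  (mfun_class f : T -> R) = f %[ae mu].
Proof.
pose g := mfun_measurableTypeR f.
have /eqmodP/asboolP// :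
    repr (mfun_class f) = g %[mod {mfun_ mu, T >-> measurableTypeR R}].
by rewrite reprK.
Qed.

Lemma finite_norm_mfun_class f : finite_norm mu p (mfun_class f).
Proof.
rewrite /finite_norm (@eq_Lnorm_ae _ (EFin \o f)).
- exact: Lfunction_finite.
- exact: lt_le_trans p1.
- by apply/measurable_EFinP; exact: (measurable_funPT (mfun_R (repr (mfun_class f)))).
- exact/measurable_EFinP.
- by apply: filterS (mfun_class_ae f) => x + Dx => /(_ Dx) /= ->.
Qed.

Definition Lclass f : LspaceType mu p1 :=
  HB.pack (mfun_class f)
    (isFinLebesgue.Build d T R mu p p1 _ (finite_norm_mfun_class f)).

Definition Lrepr_mfun F : {mfun T >-> R} :=
  mfun_R (repr (F : {mfun_ mu, T >-> measurableTypeR R})).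

Definition Lrepr F : LfunType mu p1 :=
  HB.pack (Lrepr_mfun F : T -> R) (MeasurableFun.class (Lrepr_mfun F))
    (@isLfunction.Build d T R mu p p1 (Lrepr_mfun F)
      (@Lebesgue_finite _ _ _ _ _ _ F)).

Lemma Lclass_ae f : (Lrepr (Lclass f) : T -> R) = f %[ae mu].
Proof. exact: mfun_class_ae. Qed.

Lemma Lspace_eq F G : (Lrepr F : T -> R) = Lrepr G %[ae mu] -> F = G.
Proof.
case: F G => [F [[hF]]] [G [[hG]]] FG.
have eFG : F = G by rewrite -[F]reprK -[G]reprK; apply/eqmodP/asboolP.
by subst G; rewrite (Prop_irrelevance hF hG).
Qed.

Lemma Lclass_eq f g : Lclass f = Lclass g <-> (f : T -> R) = g %[ae mu].
Proof.
split=> [fg|fg].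
  apply: ae_eq_trans (Lclass_ae g); rewrite -fg; apply: ae_eq_sym.
  exact: Lclass_ae.
apply: Lspace_eq; apply: ae_eq_trans (Lclass_ae f) _; apply: ae_eq_trans fg _.
by apply: ae_eq_sym; exact: Lclass_ae.
Qed.

Lemma LreprK F : Lclass (Lrepr F) = F.
Proof. by apply: Lspace_eq; exact: Lclass_ae. Qed.

Let Ladd F G := Lclass (Lrepr F + Lrepr G).
Let Lopp F := Lclass (- Lrepr F).
Let Lscale (a : R) F := Lclass (a *: Lrepr F).

Let LclassD f g : Ladd (Lclass f) (Lclass g) = Lclass (f + g).
Proof.
apply/Lclass_eq; move: (Lclass_ae f) (Lclass_ae g).
apply: filterS2 => x /(_ I) hf /(_ I) hg _.
by rewrite -[LHS]/(Lrepr _ x + Lrepr _ x) hf hg.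
Qed.

Let LclassN f : Lopp (Lclass f) = Lclass (- f).
Proof.
apply/Lclass_eq; apply: filterS (Lclass_ae f) => x /(_ I) hf _.
by rewrite -[LHS]/(- Lrepr _ x) hf.
Qed.

Let LclassZ a f : Lscale a (Lclass f) = Lclass (a *: f).
Proof.
apply/Lclass_eq; apply: filterS (Lclass_ae f) => x /(_ I) hf _.
by rewrite -[LHS]/(a * Lrepr _ x) hf.
Qed.

Let LaddA : associative Ladd.
Proof.
by move=> F G H; rewrite -(LreprK F) -(LreprK G) -(LreprK H) !LclassD addrA.
Qed.

Let LaddC : commutative Ladd.
Proof. by move=> F G; rewrite -(LreprK F) -(LreprK G) !LclassD addrC. Qed.

Let Ladd0 : left_id (Lclass 0) Ladd.
Proof. by move=> F; rewrite -(LreprK F) LclassD add0r. Qed.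

Let LaddN : left_inverse (Lclass 0) Lopp Ladd.
Proof. by move=> F; rewrite -(LreprK F) LclassN LclassD addNr. Qed.

HB.instance Definition _ := gen_eqMixin (LspaceType mu p1).
HB.instance Definition _ := gen_choiceMixin (LspaceType mu p1).
HB.instance Definition _ := GRing.isZmodule.Build (LspaceType mu p1)
  LaddA LaddC Ladd0 LaddN.

Let LscaleA a b F : Lscale a (Lscale b F) = Lscale (a * b) F.
Proof. by rewrite -(LreprK F) !LclassZ scalerA. Qed.

Let Lscale1 : left_id 1 Lscale.
Proof. by move=> F; rewrite -(LreprK F) LclassZ scale1r. Qed.

Let LscaleDr : right_distributive Lscale +%R.
Proof.
by move=> a F G; rewrite -(LreprK F) -(LreprK G) [_ + _]LclassD !LclassZ
  [RHS]LclassD scalerDr.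
Qed.

Let LscaleDl F : {morph Lscale^~ F : a b / a + b}.
Proof.
by move=> a b; rewrite -(LreprK F) !LclassZ [RHS]LclassD scalerDl.
Qed.

HB.instance Definition _ := GRing.Zmodule_isLmodule.Build R (LspaceType mu p1)
  LscaleA Lscale1 LscaleDr LscaleDl.

Let Lnm F : R := fine ('N[mu]_p[EFin \o (Lrepr F : T -> R)])%E.

Let Lnm_class f : Lnm (Lclass f) = fine ('N[mu]_p[EFin \o (f : T -> R)])%E.
Proof.
congr fine; apply: eq_Lnorm_ae; first exact: lt_le_trans p1.
- exact/measurable_EFinP.
- exact/measurable_EFinP.
- by apply: filterS (Lclass_ae f) => x + Dx => /(_ Dx) /= ->.
Qed.

Let LnmD F G : Lnm (F + G) <= Lnm F + Lnm G.
Proof. by rewrite Lnm_class; exact: ler_LnormD. Qed.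

Let LnmZ a F : Lnm (a *: F) = `|a| * Lnm F.
Proof.
by rewrite Lnm_class; have := LnormZ (Lrepr F) a => /(congr1 fine) ->;
  rewrite -finite_norm_fine -EFinM.
Qed.

Let Lnm0 F : Lnm F = 0 -> F = 0.
Proof.
move=> /fine_Lnormr_eq0 F0; rewrite -(LreprK F); exact/Lclass_eq.
Qed.

HB.instance Definition _ := Lmodule_isNormed.Build R (LspaceType mu p1)
  LnmD LnmZ Lnm0.

Lemma LspaceD f g : Lclass f + Lclass g = Lclass (f + g).
Proof. exact: LclassD. Qed.

Lemma LspaceN f : - Lclass f = Lclass (- f).
Proof. exact: LclassN. Qed.

Lemma LspaceZ a f : a *: Lclass f = Lclass (a *: f).
Proof. exact: LclassZ. Qed.

Lemma Lspace_normE f :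
  `|Lclass f| = fine ('N[mu]_p[EFin \o (f : T -> R)])%E.
Proof. exact: Lnm_class. Qed.

End LspaceNormedModule.

Section ContinuousLinear.
Context {R : realType} {V W : normedModType R}.

Definition clinear : {pred V -> W} :=
  fun f => `[< linear f /\ continuous f >].

Lemma clinearP (f : V -> W) :
  reflect (linear f /\ continuous f) (f \in clinear).
Proof. exact: asboolP. Qed.

Lemma clinear_submod_closed : submod_closed clinear.
Proof.
split=> [|a f g /clinearP[lf cf] /clinearP[lg cg]]; apply/clinearP.
  by split=> [k x y|x]; [rewrite scaler0 addr0 | exact: cvg_cst].
split=> [k x y|x]; last by apply: cvgD; [apply: cvgZr; exact: cf|exact: cg].
by rewrite !fctE lf lg !scalerDr addrACA scalerA mulrC -scalerA.
Qed.

HB.instance Definition _ :=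
  GRing.isSubmodClosed.Build R (V -> W) clinear clinear_submod_closed.

Record clin := Clin { clin_fun :> V -> W ; _ : clin_fun \in clinear }.

HB.instance Definition _ := [isSub for clin_fun].
HB.instance Definition _ := [Choice of clin by <:].
HB.instance Definition _ := [SubChoice_isSubLmodule of clin by <:].

Lemma clinP (f : clin) : linear f /\ continuous f.
Proof. by apply/clinearP; case: f. Qed.

Definition opnorm (f : clin) : R := sup [set `|f x| | x in [set x | `|x| <= 1]].

Let linE (f : clin) : exists g : {linear V -> W}, g = f :> (V -> W).
Proof.
have [lf _] := clinP f.
pose g : {linear V -> W} :=
  HB.pack (f : V -> W) (GRing.isLinear.Build R V W *:%R f lf).
by exists g.
Qed.

Let clinZ (f : clin) a x : f (a *: x) = a *: f x.
Proof. by have [g <-] := linE f; rewrite linearZ. Qed.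

Let clin0 (f : clin) : f 0 = 0.
Proof. by have [g <-] := linE f; rewrite linear0. Qed.

Let opnorm_has_sup (f : clin) :
  has_sup [set `|f x| | x in [set x | `|x| <= 1]].
Proof.
have [_ cf] := clinP f; split; first by exists `|f 0|, 0; rewrite //= normr0.
have [g gf] := linE f.
have : bounded_near g (nbhs (0 : V)).
  by apply/linear_bounded_continuous; rewrite gf.
move=> /bounded_funP /(_ 1)[M gM]; exists M => _ [x x1 <-].
by rewrite -gf; exact: gM.
Qed.

Lemma opnorm_ub (f : clin) x : `|x| <= 1 -> `|f x| <= opnorm f.
Proof. by move=> x1; apply: (sup_upper_bound (opnorm_has_sup f)); exists x. Qed.

Lemma opnorm_le (f : clin) M :
  (forall x, `|x| <= 1 -> `|f x| <= M) -> opnorm f <= M.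
Proof.
move=> fM; apply: ge_sup; first by have [] := opnorm_has_sup f.
by move=> _ [x x1 <-]; exact: fM.
Qed.

Let opnormD (f g : clin) : opnorm (f + g) <= opnorm f + opnorm g.
Proof.
apply: opnorm_le => x x1; apply: le_trans (ler_normD _ _) _.
by apply: lerD; exact: opnorm_ub.
Qed.

Let opnormZ_le (a : R) (f : clin) : opnorm (a *: f) <= `|a| * opnorm f.
Proof.
apply: opnorm_le => x x1.
by rewrite -[(a *: f) x]/(a *: f x) normrZ ler_wpM2l//; exact: opnorm_ub.
Qed.

Let opnormZ (a : R) (f : clin) : opnorm (a *: f) = `|a| * opnorm f.
Proof.
apply/eqP; rewrite eq_le opnormZ_le/=; have [->|a0] := eqVneq a 0.
  rewrite normr0 mul0r; apply: le_trans (opnorm_ub _ (_ : `|0| <= 1)) => //.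
  by rewrite normr0.
have aV : `|a| * `|a^-1| = 1 by rewrite -normrM divff// normr1.
rewrite -[f in leLHS]scale1r -(mulVf a0) -scalerA.
by rewrite (le_trans (ler_wpM2l _ (opnormZ_le _ _)))// mulrA aV mul1r.
Qed.

Let opnorm0 (f : clin) : opnorm f = 0 -> f = 0.
Proof.
move=> f0; apply/val_inj/funext => x; rewrite -[RHS]/(0 : W).
have [->|x0] := eqVneq x 0; first exact: clin0.
have nx : `|x| != 0 by rewrite normr_eq0.
have : `|f (`|x|^-1 *: x)| <= 0.
  by rewrite -f0 opnorm_ub// normrZ normfV normr_id mulVf.
rewrite normr_le0 clinZ scaler_eq0 invr_eq0 (negbTE nx)/= => /eqP.
by [].
Qed.

HB.instance Definition _ := Lmodule_isNormed.Build R clin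
  opnormD opnormZ opnorm0.

End ContinuousLinear.
Arguments clin {R} V W.

(* [clinn X W n] is L(X, L(X, ... L(X, W))), the space of continuous n-linear
   maps in which the n-th Frechet derivatives live. *)
Fixpoint clinn {R : realType} (X W : normedModType R) (n : nat) :
    normedModType R :=
  if n is n'.+1 then clin X (clinn X W n') else W.

Section PartialDerivatives.
Context {R : realType} {U V : normedModType R}.

Definition partially_differentiable1 {W : normedModType R} (F : U * V -> W) :=
  forall x : U * V, differentiable (fun u : U => F (u, x.2)) (x.1).

Definition partially_differentiable2 {W : normedModType R} (F : U * V -> W) :=
  forall x : U * V, differentiable (fun v : V => F (x.1, v)) (x.2).

(* See [partial1E] and [partial2E]: the default value 0 is only reached where
   the partial map is not differentiable. *)
Definition partial1 {W : normedModType R} (F : U * V -> W) (x : U * V) :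
    clin U W :=
  insubd 0 ('d (fun u : U => F (u, x.2)) (x.1) : U -> W).

Definition partial2 {W : normedModType R} (F : U * V -> W) (x : U * V) :
    clin V W :=
  insubd 0 ('d (fun v : V => F (x.1, v)) (x.2) : V -> W).

Lemma partial1E {W : normedModType R} (F : U * V -> W) (x : U * V) :
  differentiable (fun u : U => F (u, x.2)) (x.1) ->
  partial1 F x = 'd (fun u : U => F (u, x.2)) (x.1) :> (U -> W).
Proof.
move=> dF; rewrite -[LHS]/(val _) val_insubd ifT//; apply/clinearP; split.
  exact: linearP.
exact: diff_continuous.
Qed.

Lemma partial2E {W : normedModType R} (F : U * V -> W) (x : U * V) :
  differentiable (fun v : V => F (x.1, v)) (x.2) ->
  partial2 F x = 'd (fun v : V => F (x.1, v)) (x.2) :> (V -> W).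
Proof.
move=> dF; rewrite -[LHS]/(val _) val_insubd ifT//; apply/clinearP; split.
  exact: linearP.
exact: diff_continuous.
Qed.

Fixpoint partial1n {W : normedModType R} (n : nat) (F : U * V -> W) :
    U * V -> clinn U W n :=
  match n return U * V -> clinn U W n with
  | 0 => F
  | n'.+1 => partial1 (partial1n n' F)
  end.

Fixpoint partial2n {W : normedModType R} (n : nat) (F : U * V -> W) :
    U * V -> clinn V W n :=
  match n return U * V -> clinn V W n with
  | 0 => F
  | n'.+1 => partial2 (partial2n n' F)
  end.

(* In D_1^i' D_2^j' F, the derivatives in the second argument are taken
   first. *)
Definition mixed_partial {W : normedModType R} (i j : nat) (F : U * V -> W) :
    U * V -> clinn U (clinn V W j) i :=
  partial1n i (partial2n j F).

Definition has_mixed_partial {W : normedModType R} (i j : nat)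
    (F : U * V -> W) : Prop :=
  (forall k, (k < j)%N -> partially_differentiable2 (partial2n k F)) /\
  (forall k, (k < i)%N -> partially_differentiable1 (mixed_partial k j F)).

Definition class_C {W : normedModType R} (i j : nat) (F : U * V -> W) : Prop :=
  forall i' j', (i' <= i)%N -> (j' <= j)%N ->
    has_mixed_partial i' j' F /\ continuous (mixed_partial i' j' F).

End PartialDerivatives.

Lemma exponent_ge1 {R : realType} {lambda : R} :
  2 <= lambda -> (1 <= lambda%:E)%E.
Proof. by move=> h; rewrite lee_fin (le_trans _ h)// ler1n. Qed.

Section Manifold.
Context {d : measure_display} {T : measurableType d} {R : realType}.
Local Notation fmeasure := {finite_measure set T -> \bar R}.
Variables (mu : probability T R) (lambda : R).

(* A Radon-Nikodym derivative is finite everywhere when P << mu, so that [fine]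
   only changes the codomain. *)
Definition density (P : fmeasure) (x : T) : R :=
  fine (Radon_Nikodym (charge_of_finite_measure P) mu x).

Definition manifold : set fmeasure := [set P : fmeasure |
  [/\ P `<< mu, mu `<< P,
      (\int[mu]_x (density P x `^ lambda)%:E < +oo)%E &
      (\int[mu]_x (`|ln (density P x)| `^ lambda)%:E < +oo)%E]].

Context (lambda2 : 2 <= lambda).

Definition model_space : normedModType R :=
  LspaceType mu (exponent_ge1 lambda2).

Definition chart_fun (P : fmeasure) (x : T) : R :=
  density P x - 1 + ln (density P x).

(* [insubd] supplies the class of [chart_fun P] when this function is in
   L^lambda, which is the case for every P in the manifold. *)
Definition chart (P : fmeasure) : model_space :=
  Lclass (insubd (0 : LfunType mu (exponent_ge1 lambda2)) (chart_fun P)).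

Definition chart_inv : model_space -> fmeasure :=
  'pinv_(fun=> mu : fmeasure) manifold chart.

Definition manifold_class_C (i j : nat)
    (D : fmeasure -> fmeasure -> R) : Prop :=
  class_C i j (fun ab : model_space * model_space =>
    D (chart_inv ab.1) (chart_inv ab.2)).

Local Open Scope ereal_scope.

Definition divergence (alpha : R) (P Q : fmeasure) : \bar R :=
  let p := density P in
  let q := density Q in
  if (alpha == -1)%R then
    Q [set: T] - P [set: T] + \int[mu]_x (p x * ln (p x / q x))%:E
  else if (alpha == 1)%R then
    P [set: T] - Q [set: T] + \int[mu]_x (q x * ln (q x / p x))%:E
  else
    (2 / (1 + alpha))%:E * P [set: T] + (2 / (1 - alpha))%:E * Q [set: T]
    - (4 / (1 - alpha ^+ 2))%:E *
      \int[mu]_x (p x `^ ((1 - alpha) / 2) * q x `^ ((1 + alpha) / 2))%:E.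

End Manifold.

(* Main.v *)
Require Import Defs.
From HB Require Import structures.
From mathcomp Require Import all_boot all_order all_algebra.
From mathcomp Require Import all_classical all_reals all_analysis.
From mathcomp Require Import measurable_realfun.
From mathcomp Require Import ring lra zify.

(** In the chart, a point of the manifold is a function a in L^lambda, and the
    density of the corresponding measure is psi o a, where psi is the inverse
    of y |-> y - 1 + ln y. The divergence becomes the integral functional

      (a, b) |-> integral of f (a w, b w)

    with an explicit smooth function f of two real variables, a sum of terms
    depending on x or on y alone and of a product of functions of x and of y.
    Differentiating formally under the integral sign, the mixed derivative of
    order (i, j) is the multilinear form

      (u1, ..., ui, v1, ..., vj) |->
        integral of (d1^i d2^j f)(a, b) * u1 * ... * ui * v1 * ... * vj,

    which by Hoelder's inequality is bounded as soon as the coefficient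
    (d1^i d2^j f)(a, b) has finite norm of exponent lambda / (lambda - i - j).
    Two facts make this work.

    The chart balances psi at infinity, where psi x is of order x, and
    at minus infinity, where ln (psi x) is of order x: the derivatives of psi,
    of ln psi and of psi ^ s for 0 <= s <= 1 are all bounded, and so are those
    of psi ln psi from the second one on ([symbol_class]). Consequently f has
    at most quadratic growth, its derivatives in a single variable have at most
    linear growth, and its properly mixed derivatives are bounded
    ([symbol_family]). The hypotheses on i, j and lambda say exactly that the
    growth of the coefficient plus the number of directions does not exceed
    lambda, with i + j < lambda ([admissible]).

    Superposition with a continuous function of growth of order t is continuous
    from L^lambda to L^(lambda / t), also in the borderline case in which
    Hoelder's inequality leaves no room; for lambda an integer this is the case
    of the top derivatives in a single variable. The quantitative form used here,
    [superposition_small], rests on truncation and dominated convergence. It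
    gives the continuity of the derivatives ([family_map_continuous]) and,
    applied to the Taylor remainder divided by the increment, their
    existence ([superposition_diff]). An induction on the order identifies the
    iterated partial derivatives with the multilinear forms above
    ([family_map_mixed_partial]).

    Nonnegativity and finiteness of the divergence follow from the same
    representation, since f is nonnegative and f (a, b) is integrable. *)

Set Implicit Arguments.
Unset Strict Implicit.
Unset Printing Implicit Defensive.
Import Order.TTheory GRing.Theory Num.Theory.
Import numFieldNormedType.Exports.
Local Open Scope classical_set_scope.
Local Open Scope ring_scope.

(** * Functions of one variable with bounded derivatives *)

Section MeanValue.
Context {R : realType}.
Implicit Types f df : R -> R.

Lemma is_derive_continuous f df :
  (forall x : R, is_derive x 1 f (df x)) -> continuous f.
Proof.
by move=> fdf x; apply/differentiable_continuous/derivable1_diffP.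
Qed.

Lemma is_derive_measurable f df :
  (forall x : R, is_derive x 1 f (df x)) -> measurable_fun [set: R] f.
Proof.
by move=> /is_derive_continuous cf; exact: continuous_measurable_fun.
Qed.

(** The increment may have either sign, and only the size of the intermediate
    point matters: this is the form in which growth bounds on a derivative
    become bounds on increments. *)
Lemma mean_value f df x u : (forall x : R, is_derive x 1 f (df x)) ->
  exists c, [/\ `|c| <= `|x| + `|u|, `|c - x| <= `|u| &
    f (x + u) - f x = df c * u].
Proof.
move=> fdf; have cf (A : set R) : {within A, continuous f}.
  by apply: continuous_subspaceT; exact: is_derive_continuous fdf.
suff [c [cx ->]] : exists c, `|c - x| <= `|u| /\ f (x + u) - f x = df c * u.
  exists c; split=> //; rewrite -[c in leLHS](subrK x) addrC.
  by rewrite (le_trans (ler_normD _ _))// lerD2l.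
have [u0|u0] := leP 0 u.
  have [|c] := @MVT_segment R f df x (x + u) _ (fun z _ => fdf z) (cf _).
    by rewrite lerDl.
  rewrite in_itv/= => /andP[xc cu]; rewrite addrAC subrr add0r => fE.
  by exists c; split => //; rewrite !ger0_norm ?subr_ge0// lerBlDl.
have [|c] := @MVT_segment R f df (x + u) x _ (fun z _ => fdf z) (cf _).
  by rewrite gerDl ltW.
rewrite in_itv/= => /andP[xc cu] fE; exists c; split.
  by rewrite ler0_norm ?subr_le0// (ltr0_norm u0) opprB; lra.
by rewrite -[LHS]opprB fE; ring.
Qed.

End MeanValue.

Section BoundedDerivatives.
Context {R : realType}.
Implicit Types f g df : R -> R.

Definition bounded_on_line f := exists M, forall x, `|f x| <= M.

Lemma bounded_on_lineD f g : bounded_on_line f -> bounded_on_line g ->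
  bounded_on_line (f \+ g).
Proof.
move=> [M fM] [N gN]; exists (M + N) => x.
by rewrite (le_trans (ler_normD _ _))// lerD.
Qed.

Lemma bounded_on_lineM f g : bounded_on_line f -> bounded_on_line g ->
  bounded_on_line (f \* g).
Proof.
move=> [M fM] [N gN]; exists (M * N) => x.
by rewrite normrM ler_pM.
Qed.

(** Truncated at order [n] so that a function solving an autonomous
    differential equation, such as [slope], can be treated by induction on
    [n]: the equation writes its derivative as a polynomial in functions whose
    first [n] derivatives are already controlled. *)
Fixpoint bounded_derivatives n f : Prop :=
  if n is n'.+1 then
    bounded_on_line f /\ exists2 df, (forall x : R, is_derive x 1 f (df x)) &
      bounded_derivatives n' df
  else bounded_on_line f.

Lemma bounded_derivativesW n f :
  bounded_derivatives n.+1 f -> bounded_derivatives n f.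
Proof.
elim: n f => [f []//|n IH f [bf [df fdf /IH bdf]]].
by split=> //; exists df.
Qed.

Lemma bounded_derivatives_cst n c : bounded_derivatives n (cst c).
Proof.
have bcst a : bounded_on_line (cst a) by exists `|a|.
elim: n c => [//|n IH] c; split=> //; exists (cst 0) => //.
by move=> x; exact: is_derive_cst.
Qed.

Lemma bounded_derivativesD n f g : bounded_derivatives n f ->
  bounded_derivatives n g -> bounded_derivatives n (f \+ g).
Proof.
elim: n f g => [f g|n IH f g [bf [df fdf bdf]] [bg [dg gdg bdg]]].
  exact: bounded_on_lineD.
split; first exact: bounded_on_lineD.
exists (df \+ dg); last exact: IH.
by move=> x; exact: is_deriveD.
Qed.

(** Leibniz: both factors of each term of the derivative are controlled at
    order [n] once [f] and [g] are controlled at order [n.+1]. *)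
Lemma bounded_derivativesM n f g : bounded_derivatives n f ->
  bounded_derivatives n g -> bounded_derivatives n (f \* g).
Proof.
elim: n f g => [f g|n IH f g bdf0 bdg0]; first exact: bounded_on_lineM.
have [bf [df fdf bdf]] := bdf0; have [bg [dg gdg bdg]] := bdg0.
split; first exact: bounded_on_lineM.
exists ((f \* dg) \+ (g \* df)).
  by move=> x; exact: is_deriveM.
by apply: bounded_derivativesD; apply: IH => //; exact: bounded_derivativesW.
Qed.

Lemma bounded_derivativesN n f : bounded_derivatives n f ->
  bounded_derivatives n (\- f).
Proof.
move=> bf; rewrite (_ : \- f = cst (-1) \* f).
  by apply: bounded_derivativesM => //; exact: bounded_derivatives_cst.
by apply/funext => x /=; rewrite mulN1r.
Qed.

Lemma is_derive_derive1 f df :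
  (forall x : R, is_derive x 1 f (df x)) -> derive1 f = df.
Proof. by move=> fdf; apply/funext => x; rewrite derive1E derive_val. Qed.

Lemma bounded_derivativesP f : (forall n, bounded_derivatives n f) ->
  forall n, bounded_on_line (derive1n n f) /\
    (forall x : R, is_derive x 1 (derive1n n f) (derive1n n.+1 f x)).
Proof.
move=> bf n; elim: n f bf => [f bf|n IH f bf].
  have [bf0 [df fdf _]] := bf 1%N.
  by split=> // x; rewrite derive1n1 (is_derive_derive1 fdf).
have [bf0 [df fdf _]] := bf 1%N.
have fE := is_derive_derive1 fdf.
rewrite derive1Sn derive1Sn fE; apply: IH => m.
by have [_ [dg gdg]] := bf m.+1; rewrite -fE (is_derive_derive1 gdg).
Qed.

End BoundedDerivatives.

(** * The inverse of the chart function *)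

Section ChartInverse.
Context {R : realType}.
Implicit Types x y s t : R.

Let F (l : R) := expR l - 1 + l.

Let F_derive x : is_derive x 1 F (expR x + 1).
Proof. by apply: is_derive_eq; rewrite subr0. Qed.

Let F_inc : {mono F : x y / x <= y}.
Proof.
apply: le_mono => x y xy; rewrite /F.
by rewrite ltrD// ltrD2r ltr_expR.
Qed.

Let F_surj x : exists l, F l = x.
Proof.
have cF (A : set R) : {within A, continuous F}.
  by apply: continuous_subspaceT; exact: is_derive_continuous F_derive.
have b0 : - `|x| - 1 <= `|x| + 1.
  by have := normr_ge0 x; lra.
have Fb : F (`|x| + 1) >= x.
  rewrite /F; have := expR_ge1Dx (`|x| + 1); have := ler_norm x.
  by have := normr_ge0 x; lra.
have Fa : F (- `|x| - 1) <= x.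
  rewrite /F; have : expR (- `|x| - 1) <= 1.
    by rewrite expR_le1; have := normr_ge0 x; lra.
  by have := ler_norm (- x); rewrite normrN; lra.
have [|l _ Fl] := @IVT R F _ _ x b0 (cF _); last by exists l.
by rewrite ge_min le_max Fa Fb orbT.
Qed.

(** The equation y - 1 + ln y = x is solved in the logarithmic variable
    l = ln y, where the left-hand side exp l - 1 + l is a smooth increasing
    bijection of the line: thus [psi] is the inverse of the chart function,
    [ell] is ln [psi], and [slope] is the derivative of [ell]. *)
Definition ell x : R := xget 0 [set l | expR l - 1 + l = x].
Definition psi x : R := expR (ell x).
Definition slope x : R := (1 + psi x)^-1.

Let FK x : F (ell x) = x.
Proof. by rewrite /ell; case: xgetP => // /(_ _) H; have [l /H] := F_surj x. Qed.

Let ellK : cancel F ell.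
Proof. by move=> l; apply: (inc_inj F_inc); rewrite FK. Qed.

Lemma psi_gt0 x : 0 < psi x.
Proof. exact: expR_gt0. Qed.

Lemma ln_psi x : ln (psi x) = ell x.
Proof. exact: expRK. Qed.

Lemma psi_ell x : psi x - 1 + ell x = x.
Proof. exact: FK. Qed.

Lemma ell_eq p : 0 < p -> ell (p - 1 + ln p) = ln p.
Proof. by move=> p0; rewrite -[RHS]ellK /F lnK. Qed.

Lemma psi_eq p : 0 < p -> psi (p - 1 + ln p) = p.
Proof. by move=> p0; rewrite /psi ell_eq// lnK. Qed.

(** For [psi x >= 1] the logarithm is nonnegative, so [psi x <= x + 1]. *)
Lemma psi_le x : psi x <= 1 + `|x|.
Proof.
have [p1|p1] := leP (psi x) 1; first by rewrite (le_trans p1)// lerDl.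
have := psi_ell x; have : 0 <= ell x by rewrite -ln_psi ln_ge0// ltW.
by have := ler_norm x; lra.
Qed.

Lemma slope_gt0 x : 0 < slope x.
Proof. by rewrite invr_gt0 addr_gt0// psi_gt0. Qed.

Lemma slope_lt1 x : slope x < 1.
Proof. by rewrite invf_lt1 ?ltrDl ?psi_gt0// addr_gt0// psi_gt0. Qed.

Let is_derive_eqR (f : R -> R) (x a b : R) :
  is_derive x 1 f a -> a = b -> is_derive x 1 f b.
Proof. by move=> fa <-. Qed.

Let psi1_neq0 x : 1 + psi x != 0.
Proof. by rewrite gt_eqF// addr_gt0// psi_gt0. Qed.

(** This identity eliminates [psi] from the derivatives of [psi] and [slope],
    which become polynomials in [slope]. *)
Lemma psi_slope x : psi x * slope x = 1 - slope x.
Proof. by rewrite /slope; field; exact: psi1_neq0. Qed.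

Lemma is_derive_ell x : is_derive x 1 ell (slope x).
Proof.
rewrite -[x in is_derive x](FK x) /slope -[psi x]/(expR (ell x)) addrC.
apply: (@is_derive_inverse R F).
- by near=> z; exact: ellK.
- by near=> z; exact: is_derive_continuous F_derive z.
- exact: F_derive.
- by rewrite gt_eqF// addr_gt0// expR_gt0.
Unshelve. all: by end_near. Qed.

Lemma is_derive_psi x : is_derive x 1 psi (1 - slope x).
Proof.
rewrite -psi_slope.
exact: (@is_derive1_comp R expR ell x _ _ (is_derive_expR _) (is_derive_ell x)).
Qed.

Lemma is_derive_slope x :
  is_derive x 1 slope (- ((1 - slope x) * slope x * slope x)).
Proof.
have := @is_deriveV R (fun x => 1 + psi x) x (1 - slope x) 1 (psi1_neq0 x).
have h : is_derive x 1 (fun x => 1 + psi x) (1 - slope x).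
  have h := is_deriveD (is_derive_cst (1 : R) x 1) (is_derive_psi x).
  by apply: (is_derive_eqR h); rewrite add0r.
move=> /(_ h) {}h; apply: (is_derive_eqR h).
rewrite -[_ *: _]/(_ * _) /slope; field; exact: psi1_neq0.
Qed.

Definition psipow s x : R := psi x `^ s.

Lemma psipowE s x : psipow s x = expR (s * ell x).
Proof. by rewrite /psipow /psi mulrC expRM. Qed.

Lemma is_derive_psipow s x :
  is_derive x 1 (psipow s) (s * (psipow s x * slope x)).
Proof.
rewrite (_ : psipow s = expR \o (fun x => s * ell x)); last first.
  by apply/funext => y; rewrite psipowE.
have h : is_derive x 1 (fun x => s * ell x) (s * slope x).
  exact: (is_derive_eqR (is_deriveZ s (is_derive_ell x))).
apply: (is_derive_eqR (@is_derive1_comp R expR _ _ _ _ _ h)).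
by rewrite /=; ring.
Qed.

End ChartInverse.

(** * Growth of the derivatives of functions of the chart variable *)

Section SymbolClasses.
Context {R : realType}.
Implicit Types (f df : R -> R) (r n k : nat).

(** Derivatives grow like those of a polynomial of degree [r]; the truncated
    subtraction [r - k] makes all derivatives of order at least [r]
    bounded. *)
Definition symbol_class r f := forall k,
  (forall x : R, is_derive x 1 (derive1n k f) (derive1n k.+1 f x)) /\
  exists2 C, 0 <= C & forall x, `|derive1n k f x| <= C * (1 + `|x|) ^+ (r - k).

Lemma bounded_symbol f : (forall n, bounded_derivatives n f) ->
  symbol_class 0 f.
Proof.
move=> /bounded_derivativesP bf k; have [[M fM] fdf] := bf k.
split=> //; exists M; first exact: le_trans (fM 0).
by move=> x; rewrite sub0n expr0 mulr1.
Qed.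

(** A primitive gains one power of growth, by the mean value theorem. *)
Lemma primitive_symbol r f df : (forall x : R, is_derive x 1 f (df x)) ->
  symbol_class r df -> symbol_class r.+1 f.
Proof.
move=> fdf sdf [|k]; last first.
  rewrite (derive1Sn f k) (derive1Sn f k.+1) (is_derive_derive1 fdf) subSS.
  exact: sdf.
split; first by move=> x; rewrite derive1n1 (is_derive_derive1 fdf).
have [_ [C C0 dfC]] := sdf 0%N.
exists (`|f 0| + C) => [|x]; first exact: addr_ge0.
have [c [cx _]] := mean_value 0 x fdf; rewrite add0r => /eqP.
rewrite subr_eq => /eqP; rewrite /= => ->.
have c1 : 1 + `|c| <= 1 + `|x| by rewrite lerD2l (le_trans cx)// normr0 add0r.
have x1 : 1 <= 1 + `|x| by rewrite lerDl.
rewrite (le_trans (ler_normD _ _))// addrC mulrDl lerD//; last first.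
  rewrite normrM subn0 exprSr mulrA ler_pM//; last by rewrite lerDr.
  have := dfC c; rewrite subn0 => /le_trans; apply.
  by rewrite ler_wpM2l// lerXn2r// nnegrE addr_ge0.
by rewrite ler_peMr// exprn_ege1.
Qed.

End SymbolClasses.

Section ChartSymbols.
Context {R : realType}.
Implicit Types (s x : R).

Let mulD (f g : R -> R) (x a b : R) : is_derive x 1 f a ->
  is_derive x 1 g b -> is_derive x 1 (f \* g) (f x * b + g x * a).
Proof. by move=> fdf gdg; exact: is_deriveM. Qed.

Lemma bounded_derivatives_slope n : bounded_derivatives n (@slope R).
Proof.
have bs : bounded_on_line (@slope R).
  by exists 1 => x; rewrite ger0_norm ltW ?slope_lt1 ?slope_gt0.
elim: n => [//|n IH]; split => //.
exists (\- (((cst 1 \- @slope R) \* @slope R) \* @slope R)).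
  exact: is_derive_slope.
apply/bounded_derivativesN/bounded_derivativesM => //.
apply/bounded_derivativesM => //; apply: bounded_derivativesD.
  exact: bounded_derivatives_cst.
exact: bounded_derivativesN.
Qed.

Let bounded_derivatives_1Bslope n :
  bounded_derivatives n (cst 1 \- @slope R).
Proof.
apply: bounded_derivativesD; first exact: bounded_derivatives_cst.
exact/bounded_derivativesN/bounded_derivatives_slope.
Qed.

(** [psipow s x * slope x] is psi ^ s / (1 + psi), and psi ^ s is at most
    max(1, psi) exactly because 0 <= s <= 1. *)
Lemma bounded_psipow_slope s : 0 <= s <= 1 ->
  bounded_on_line (psipow s \* @slope R).
Proof.
move=> /andP[s0 s1]; exists 1 => x /=.
have p0 := psi_gt0 x; have P0 : 0 < 1 + psi x by rewrite addr_gt0.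
rewrite ger0_norm; last first.
  by rewrite mulr_ge0// ?powR_ge0// ltW// slope_gt0.
rewrite /slope ler_pdivrMr// mul1r /psipow.
have [p1|/ltW p1] := leP (psi x) 1.
  rewrite (@le_trans _ _ 1)//; last by rewrite lerDl ltW.
  have [->|sn0] := eqVneq s 0; first by rewrite powRr0.
  have -> : 1 = 1 `^ s :> R by rewrite powR1.
  by rewrite ge0_ler_powR// nnegrE// ltW.
by rewrite (le_trans (ler1_powR p1 s1))// lerDr.
Qed.

(** The derivative is the function itself times a polynomial in [slope]. *)
Lemma bounded_derivatives_psipow_slope s n : 0 <= s <= 1 ->
  bounded_derivatives n (psipow s \* @slope R).
Proof.
move=> s01; have bs := bounded_psipow_slope s01.
elim: n => [//|n IH]; split => //.
exists ((psipow s \* @slope R) \*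
  ((cst s \* @slope R) \- ((cst 1 \- @slope R) \* @slope R))).
  move=> x; have := mulD (is_derive_psipow s x) (is_derive_slope x).
  by move=> h; apply: (is_derive_eq h) => /=; ring.
apply: bounded_derivativesM => //; apply: bounded_derivativesD.
  apply: bounded_derivativesM; first exact: bounded_derivatives_cst.
  exact: bounded_derivatives_slope.
apply/bounded_derivativesN/bounded_derivativesM => //.
exact: bounded_derivatives_slope.
Qed.

Lemma psipow_symbol s : 0 <= s <= 1 -> symbol_class 1 (psipow s : R -> R).
Proof.
move=> s01; apply: (primitive_symbol (is_derive_psipow s)).
apply: bounded_symbol => n; apply: bounded_derivativesM.
  exact: bounded_derivatives_cst.
exact: bounded_derivatives_psipow_slope.
Qed.

Lemma psi_symbol : symbol_class 1 (@psi R).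
Proof.
apply: (primitive_symbol (@is_derive_psi R)).
exact: bounded_symbol bounded_derivatives_1Bslope.
Qed.

Lemma ell_symbol : symbol_class 1 (@ell R).
Proof.
apply: (primitive_symbol (@is_derive_ell R)).
exact: bounded_symbol bounded_derivatives_slope.
Qed.

(** The only way in which the unbounded [ell] enters the second derivative of
    the entropy: it comes with a factor psi / (1 + psi) ^ 2, which beats the
    logarithm at both ends because |ln psi| <= psi + 1 / psi. *)
Let e : R -> R := ((cst 1 \- @slope R) \* @slope R) \* @ell R.

Let bounded_e : bounded_on_line e.
Proof.
exists 1 => x; rewrite /e /= -psi_slope -ln_psi.
have p0 := psi_gt0 x; have P0 : 0 < 1 + psi x by rewrite addr_gt0.
rewrite normrM ger0_norm; last by rewrite !mulr_ge0// ltW// slope_gt0.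
have lnp : `|ln (psi x)| <= psi x + (psi x)^-1.
  have h1 : ln (psi x) <= psi x by apply: ltW; exact: ln_sublinear.
  have h2 : - ln (psi x) <= (psi x)^-1.
    by rewrite -lnV// ltW// ln_sublinear// invr_gt0.
  have : 0 < (psi x)^-1 by rewrite invr_gt0.
  by rewrite ler_norml; lra.
rewrite (le_trans (ler_wpM2l _ lnp))//.
  by rewrite !mulr_ge0// ltW// slope_gt0.
rewrite [leLHS](_ : _ = (psi x ^+ 2 + 1) / (1 + psi x) ^+ 2); last first.
  by rewrite /slope; field; rewrite !gt_eqF.
rewrite ler_pdivrMr ?exprn_gt0// mul1r; nra.
Qed.

Let bounded_derivatives_e n : bounded_derivatives n e.
Proof.
elim: n => [|n IH]; first exact: bounded_e.
split; first exact: bounded_e.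
exists (((cst (- 1) \+ (cst 2 \* @slope R)) \* @slope R \* e) \+
  ((cst 1 \- @slope R) \* @slope R) \* @slope R).
  move=> x; rewrite /e.
  have h := is_deriveB (is_derive_cst (1 : R) x 1) (is_derive_slope x).
  have {}h := mulD (mulD h (is_derive_slope x)) (is_derive_ell x).
  by apply: (is_derive_eq h) => /=; rewrite !fctE; ring.
have bs := bounded_derivatives_slope n.
have b2 : bounded_derivatives n (cst (- 1) \+ (cst 2 \* @slope R)).
  apply: bounded_derivativesD; first exact: bounded_derivatives_cst.
  by apply: bounded_derivativesM => //; exact: bounded_derivatives_cst.
apply: bounded_derivativesD; apply: bounded_derivativesM => //;
  exact: bounded_derivativesM.
Qed.

(** The first derivative is [(1 - slope) * ell], of linear growth; from the
    second one on, derivatives are bounded. *)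
Lemma entropy_symbol : symbol_class 2 (fun x : R => psi x * ell x - psi x).
Proof.
have d1 (x : R) : is_derive x 1 (fun x : R => psi x * ell x - psi x)
    ((1 - slope x) * ell x).
  have h := is_deriveB (is_deriveM (is_derive_psi x) (is_derive_ell x))
    (is_derive_psi x).
  apply: (is_derive_eq h); rewrite -![_ *: _]/(_ * _) psi_slope; ring.
have d2 (x : R) : is_derive x 1 (fun x : R => (1 - slope x) * ell x)
    (slope x * e x + (1 - slope x) * slope x).
  have h := is_deriveM (is_deriveB (is_derive_cst (1 : R) x 1)
    (is_derive_slope x)) (is_derive_ell x).
  by apply: (is_derive_eq h); rewrite -![_ *: _]/(_ * _) /e /= !fctE; ring.
apply: (primitive_symbol d1); apply: (primitive_symbol d2).
apply: bounded_symbol => n; apply: bounded_derivativesD.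
  by apply: bounded_derivativesM => //; exact: bounded_derivatives_slope.
by apply: bounded_derivativesM => //; exact: bounded_derivatives_slope.
Qed.

End ChartSymbols.

(** * The scale of Lebesgue norms of exponents lambda / s *)

Section ScaledNorm.
Context d (T : measurableType d) (R : realType) (mu : probability T R).
Variable lambda : R.
Hypothesis lambda_ge1 : 1 <= lambda.
Implicit Types (f g A : T -> R) (s r : R).

(** Indexing the Lebesgue space of exponent lambda / s by [s] makes Hoelder's
    inequality additive: multiplication by an element of the space of index 1,
    the model space, raises the index by one, and index [lambda] means
    integrable. *)
Definition scaled_Lfun s f := f \in Lfun mu (lambda / s)%:E.

Definition scaled_norm s f : R := fine ('N[mu]_(lambda / s)%:E[EFin \o f])%E.

Let lambda_gt0 : 0 < lambda. Proof. exact: lt_le_trans ltr01 _. Qed.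

Let exponent_gt0 s : 0 < s -> 0 < lambda / s.
Proof. by move=> s0; rewrite divr_gt0. Qed.

Let exponent_ge1 s : 0 < s <= lambda -> 1 <= lambda / s.
Proof. by move=> /andP[s0 sl]; rewrite ler_pdivlMr// mul1r. Qed.

Lemma scaled_LfunP s f : scaled_Lfun s f <-> measurable_fun [set: T] f /\
  ('N[mu]_(lambda / s)%:E[EFin \o f] < +oo)%E.
Proof.
rewrite /scaled_Lfun; split.
  by rewrite inE => /andP[/[!inE]/= mf]; rewrite /finite_norm.
by move=> [mf fy]; rewrite inE; apply/andP; split; rewrite inE.
Qed.

Lemma scaled_norm_ge0 s f : 0 <= scaled_norm s f.
Proof. exact/fine_ge0/Lnorm_ge0. Qed.

Lemma scaled_normE s f : scaled_Lfun s f ->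
  ((scaled_norm s f)%:E = 'N[mu]_(lambda / s)%:E[EFin \o f])%E.
Proof.
by move=> /scaled_LfunP[mf fy]; rewrite fineK// ge0_fin_numE ?Lnorm_ge0.
Qed.

Lemma measurable_scaled_Lfun s f : scaled_Lfun s f -> measurable_fun setT f.
Proof. by move=> /scaled_LfunP[]. Qed.

Let measurable_powR_norm f r : measurable_fun setT f ->
  measurable_fun setT (fun x => `|f x| `^ r).
Proof.
move=> mf; apply: (measurableT_comp (measurable_powR _)) => //.
exact: measurableT_comp.
Qed.

Lemma le_scaled_norm s f g : 0 < s -> scaled_Lfun s g ->
  measurable_fun setT f -> (forall x, `|f x| <= `|g x|) ->
  scaled_Lfun s f /\ scaled_norm s f <= scaled_norm s g.
Proof.
move=> s0 Lg mf fg; have mg := measurable_scaled_Lfun Lg.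
have r0 := exponent_gt0 s0.
have le : ('N[mu]_(lambda / s)%:E[EFin \o f] <=
    'N[mu]_(lambda / s)%:E[EFin \o g])%E.
  rewrite unlock; apply: gt0_ler_poweR; last 3 first.
  - rewrite in_itv/= leey andbT; apply: integral_ge0 => x _.
    by rewrite /= ?lee_fin ?powR_ge0.
  - rewrite in_itv/= leey andbT; apply: integral_ge0 => x _.
    by rewrite /= ?lee_fin ?powR_ge0.
  - apply: ge0_le_integral => //=.
    + by apply/measurable_EFinP; exact: measurable_powR_norm.
    + by apply/measurable_EFinP; exact: measurable_powR_norm.
    + by move=> x _; rewrite lee_fin ge0_ler_powR// ltW.
  by rewrite invr_ge0 ltW.
have Lf : scaled_Lfun s f.
  by apply/scaled_LfunP; split=> //; apply: le_lt_trans le _;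
    have /scaled_LfunP[] := Lg.
by split=> //; rewrite -lee_fin !scaled_normE.
Qed.

Lemma scaled_Lfun_normr s f : 0 < s -> scaled_Lfun s f ->
  scaled_Lfun s (fun x => `|f x|) /\
  scaled_norm s (fun x => `|f x|) <= scaled_norm s f.
Proof.
move=> s0 Lf; have mf := measurable_scaled_Lfun Lf.
apply: le_scaled_norm => // [|x]; first exact: measurableT_comp.
by rewrite normr_id.
Qed.

Lemma scaled_LfunD s f g : 0 < s <= lambda -> scaled_Lfun s f ->
  scaled_Lfun s g -> scaled_Lfun s (f \+ g) /\
  scaled_norm s (f \+ g) <= scaled_norm s f + scaled_norm s g.
Proof.
move=> sl Lf Lg; have r1 := exponent_ge1 sl.
have [mf fy] := (scaled_LfunP _ _).1 Lf.
have [mg gy] := (scaled_LfunP _ _).1 Lg.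
have le := minkowski_EFin mu mf mg r1.
have Lfg : scaled_Lfun s (f \+ g).
  apply/scaled_LfunP; split; first exact: measurable_funD.
  by apply: le_lt_trans le _; exact: lte_add_pinfty.
by split=> //; rewrite -lee_fin EFinD !scaled_normE.
Qed.

Let Lnorm_ae s f g : 0 < s -> measurable_fun setT f ->
  measurable_fun setT g -> f = g %[ae mu] ->
  ('N[mu]_(lambda / s)%:E[EFin \o f] = 'N[mu]_(lambda / s)%:E[EFin \o g])%E.
Proof.
move=> s0 mf mg fg; apply: eq_Lnorm_ae.
- by rewrite lte_fin exponent_gt0.
- exact/measurable_EFinP.
- exact/measurable_EFinP.
- by apply: filterS fg => x + Dx => /(_ Dx) /= ->.
Qed.

Lemma scaled_norm_ae s f g : 0 < s -> measurable_fun setT f ->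
  measurable_fun setT g -> f = g %[ae mu] -> scaled_norm s f = scaled_norm s g.
Proof. by move=> s0 mf mg fg; rewrite /scaled_norm (Lnorm_ae s0 mf mg fg). Qed.

Lemma scaled_Lfun_ae s f g : 0 < s -> measurable_fun setT f ->
  f = g %[ae mu] -> scaled_Lfun s g -> scaled_Lfun s f.
Proof.
move=> s0 mf fg Lg; have [mg gy] := (scaled_LfunP _ _).1 Lg.
by apply/scaled_LfunP; rewrite (Lnorm_ae s0 mf mg fg).
Qed.

Lemma scaled_norm_cst s c : 0 < s -> scaled_norm s (cst c) = `|c|.
Proof.
move=> s0; rewrite /scaled_norm unlock.
rewrite (eq_integral (cst (`|c| `^ (lambda / s))%:E))//.
rewrite integral_cst// [X in (_ * X)%E]probability_setT mule1 -poweR_EFin.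
by rewrite -poweRrM mulfV ?poweRe1// gt_eqF// exponent_gt0.
Qed.

Lemma scaled_Lfun_cst s c : scaled_Lfun s (cst c).
Proof. exact: Lfun_cst. Qed.

Lemma scaled_LfunZ s c f : 0 < s <= lambda -> scaled_Lfun s f ->
  scaled_Lfun s (fun x => c * f x) /\
  scaled_norm s (fun x => c * f x) = `|c| * scaled_norm s f.
Proof.
move=> sl Lf; have r1 := exponent_ge1 sl.
have r1E : (1 <= (lambda / s)%:E)%E by rewrite lee_fin.
pose F : LfunType mu r1E := Lfun_Sub r1E Lf.
have Lcf : scaled_Lfun s (fun x => c * f x) := LfunP (c *: F).
split=> //; apply: EFin_inj; rewrite EFinM !scaled_normE//.
exact: (LnormZ F c).
Qed.

Lemma scaled_LfunB s f g : 0 < s <= lambda -> scaled_Lfun s f ->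
  scaled_Lfun s g -> scaled_Lfun s (f \- g).
Proof.
move=> sl Lf Lg; have [LNg _] := scaled_LfunZ (-1) sl Lg.
have [+ _] := scaled_LfunD sl Lf LNg; congr scaled_Lfun.
by apply/funext => x /=; rewrite mulN1r.
Qed.

Let Lnorm_powR f (p r : R) : 0 < p -> 0 < r ->
  ('N[mu]_p%:E[EFin \o (fun x => `|f x| `^ r)%R] =
   'N[mu]_(r * p)%:E[EFin \o f] `^ r)%E.
Proof.
move=> p0 r0; rewrite unlock /=.
under eq_integral do rewrite norm_powR// normr_id -powRrM.
by rewrite -poweRrM invfM mulrAC mulVf ?gt_eqF// mul1r.
Qed.

(** The classical inequality for the conjugate exponents s / (s - 1) and s,
    applied to the functions |f| ^ r and |g| ^ r with r = lambda / s. *)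
Lemma scaled_hoelder s f g : 1 < s <= lambda -> scaled_Lfun (s - 1) f ->
  scaled_Lfun 1 g -> scaled_Lfun s (f \* g) /\
  scaled_norm s (f \* g) <= scaled_norm (s - 1) f * scaled_norm 1 g.
Proof.
move=> /andP[s1 sl] Lf Lg; have s0 : 0 < s by exact: lt_trans s1.
have s10 : 0 < s - 1 by rewrite subr_gt0.
have mf := measurable_scaled_Lfun Lf; have mg := measurable_scaled_Lfun Lg.
pose r := lambda / s; have r0 : 0 < r := exponent_gt0 s0.
have := @hoelder _ T R mu (fun x => `|f x| `^ r) (fun x => `|g x| `^ r)
  (s / (s - 1)) s (measurable_powR_norm r mf) (measurable_powR_norm r mg).
rewrite divr_gt0// => /(_ erefl s0).
have -> : (s / (s - 1))^-1 + s^-1 = 1.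
  by rewrite invf_div -[X in _ + X]div1r -mulrDl subrK mulfV// gt_eqF.
move=> /(_ erefl); rewrite !Lnorm_powR ?divr_gt0//.
have -> : r * (s / (s - 1)) = lambda / (s - 1).
  by rewrite /r mulrA divfK// gt_eqF.
have -> : r * s = lambda / 1 by rewrite /r divfK ?divr1// gt_eqF.
rewrite -!scaled_normE// -poweRM ?lee_fin ?scaled_norm_ge0//.
have -> : ('N[mu]_1[EFin \o ((fun x => (`|f x| `^ r)%R) \*
    (fun x => (`|g x| `^ r)%R))%R])%E = ('N[mu]_r%:E[EFin \o (f \* g)%R] `^ r)%E.
  have := Lnorm_powR (f \* g) ltr01 r0; rewrite mulr1 => <-.
  apply: eq_Lnorm => x /=.
  by rewrite normrM powRM.
move=> le.
have {}le : ('N[mu]_r%:E[EFin \o (f \* g)%R] <=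
    (scaled_norm (s - 1) f * scaled_norm 1 g)%:E)%E.
  have rV0 : 0 <= r^-1 by rewrite invr_ge0 ltW.
  have N0 : (0 <= 'N[mu]_r%:E[EFin \o (f \* g)%R])%E by exact: Lnorm_ge0.
  have c0 : (0 <= (scaled_norm (s - 1) f * scaled_norm 1 g)%:E)%E.
    by rewrite lee_fin mulr_ge0 ?scaled_norm_ge0.
  have itv (x : \bar R) : (0 <= x)%E -> x \in `[0%E, +oo%E].
    by move=> x0; rewrite in_itv/= x0 leey.
  have := gt0_ler_poweR rV0 (itv _ (poweR_ge0 _ _)) (itv _ (poweR_ge0 _ _)) le.
  by rewrite -!poweRrM mulfV ?gt_eqF// !poweRe1.
have Lfg : scaled_Lfun s (f \* g).
  apply/scaled_LfunP; split; first exact: measurable_funM.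
  by apply: le_lt_trans le _; rewrite ltry.
by split=> //; rewrite -lee_fin scaled_normE.
Qed.

(** A function of growth of order [s] of an element of index 1 has
    index [s]. *)
Lemma scaled_powR s f : 0 < s -> (forall x, 0 <= f x) -> scaled_Lfun 1 f ->
  scaled_Lfun s (fun x => f x `^ s) /\
  scaled_norm s (fun x => f x `^ s) = scaled_norm 1 f `^ s.
Proof.
move=> s0 f0 Lf; have mf := measurable_scaled_Lfun Lf.
have E : ('N[mu]_(lambda / s)%:E[EFin \o (fun x => f x `^ s)%R] =
    (scaled_norm 1 f `^ s)%:E)%E.
  rewrite -poweR_EFin scaled_normE// divr1.
  have := Lnorm_powR f (exponent_gt0 s0) s0.
  rewrite mulrCA mulfV ?gt_eqF// mulr1 => <-; apply: eq_Lnorm => x /=.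
  by rewrite ger0_norm.
have Lfs : scaled_Lfun s (fun x => f x `^ s).
  apply/scaled_LfunP; rewrite E ltry; split=> //.
  exact: (measurableT_comp (measurable_powR _)).
by split=> //; apply: EFin_inj; rewrite scaled_normE.
Qed.

Lemma scaled_Lfun_sub s t f : 0 < s -> s <= t -> t <= lambda ->
  scaled_Lfun s f -> scaled_Lfun t f.
Proof.
move=> s0 st tl Lf; have t0 : 0 < t := lt_le_trans s0 st.
apply: (Lfun_subset _ _ _ _ Lf).
- by rewrite lee_fin exponent_ge1// t0.
- by rewrite lee_fin exponent_ge1// s0 (le_trans st).
- exact: fin_num_measure.
- by rewrite lee_fin ler_pM2l// lef_pV2.
Qed.

Lemma scaled_Lfun_integrable f :
  scaled_Lfun lambda f <-> mu.-integrable setT (EFin \o f).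
Proof. by rewrite /scaled_Lfun divff ?gt_eqF//; exact: Lfun1_integrable. Qed.

Lemma le_Rintegral_scaled_norm f : scaled_Lfun lambda f ->
  `|\int[mu]_x f x| <= scaled_norm lambda f.
Proof.
move=> Lf; have intf := (scaled_Lfun_integrable f).1 Lf.
rewrite (le_trans (le_normr_Rintegral _ intf))//.
by rewrite /scaled_norm divff ?gt_eqF// Lnorm1.
Qed.

(** Dominated convergence, applied to the truncations at the integers. *)
Lemma scaled_norm_truncation A (e : R) :
  (forall x, 0 <= A x) -> scaled_Lfun 1 A ->
  0 < e -> exists2 K : R, 0 < K &
    scaled_Lfun 1 (A \* \1_[set x | K < A x]) /\
    scaled_norm 1 (A \* \1_[set x | K < A x]) <= e.
Proof.
move=> A0 LA e0; have mA := measurable_scaled_Lfun LA.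
have mK K : measurable [set x | K < A x].
  rewrite (_ : [set _ | _] = [set: T] `&` A @^-1` `]K, +oo[%classic).
    exact: mA.
  by rewrite setTI; apply/seteqP; split=> x /=; rewrite in_itv/= andbT.
have LK K : scaled_Lfun 1 (A \* \1_[set x | K < A x]).
  apply: (le_scaled_norm ltr01 LA _ _).1 => [|x /=].
    exact: measurable_funM.
  by rewrite normrM ler_piMr// indicE; case: (_ \in _); rewrite ?normr1 ?normr0.
pose F n x := ((A x * \1_[set x | n%:R < A x] x) `^ lambda)%:E.
have mF n : measurable_fun setT (F n).
  apply/measurable_EFinP; apply: (measurableT_comp (measurable_powR _)) => //.
  exact: measurable_funM.
have FN n : (\int[mu]_x F n x =
    (scaled_norm 1 (A \* \1_[set x | n%:R < A x]) `^ lambda)%:E)%E.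
  have := scaled_normE (LK n%:R); rewrite divr1 => NE.
  rewrite -[RHS]poweR_EFin NE (poweR_Lnorm _ _ (lt0r_neq0 lambda_gt0)).
  apply: eq_integral => x _; rewrite /F /= ger0_norm// mulr_ge0//.
have iA : mu.-integrable setT (fun x => (A x `^ lambda)%:E).
  have := Lfun_integrable lambda_ge1 (_ : A \in Lfun mu lambda%:E).
  rewrite -[X in Lfun mu X%:E]divr1 => /(_ LA).
  by under eq_fun do rewrite ger0_norm//.
have F0 x n : (0 <= F n x)%E by rewrite lee_fin powR_ge0.
have [||_ _] := @dominated_convergence _ T R mu setT measurableT F (cst 0)
  (fun x => (A x `^ lambda)%:E) mF (measurable_cst _) _ iA _.
- apply: aeW => x _; apply: cvg_near_cst; near=> n.
  have nA : A x <= n%:R by near: n; exact: nbhs_infty_ger.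
  rewrite /F indicE memNset ?mulr0 ?powR0 ?gt_eqF//=.
  by apply/negP; rewrite -leNgt.
- apply: aeW => x n _; rewrite gee0_abs// lee_fin.
  rewrite ge0_ler_powR ?nnegrE ?(ltW lambda_gt0)//.
    by rewrite mulr_ge0// indicE.
  by rewrite ler_piMr// indicE; case: (_ \in _).
rewrite integral0 => /fine_cvgP[_ /cvgrPdist_le /(_ (e `^ lambda))].
rewrite powR_gt0// => /(_ erefl) [n _ /(_ n.+1 (leqnSn n))] /=.
rewrite sub0r normrN FN /= ger0_norm ?powR_ge0// => le.
exists n.+1%:R => //; split=> //.
rewrite leNgt; apply/negP => lt; move: le; apply/negP; rewrite -ltNge.
by rewrite gt0_ltr_powR// nnegrE ?scaled_norm_ge0// ltW.
Unshelve. all: by end_near. Qed.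

End ScaledNorm.

(** * Continuity of superposition in the scale *)

Lemma measurable_fun_inv (R : realType) :
  measurable_fun [set: R] (fun x : R => x^-1).
Proof.
rewrite (_ : (fun x => _) = (fun x : R => x * (x ^+ 2) `^ (-1))).
  apply: measurable_funM => //.
  by apply: (measurableT_comp (measurable_powR _)) => //; exact: measurable_funX.
apply/funext => x; have [->|x0] := eqVneq x 0; first by rewrite invr0 mul0r.
by rewrite powR_inv1 ?sqr_ge0// expr2 invfM mulrA mulfV// mul1r.
Qed.

Section Superposition.
Context d (T : measurableType d) (R : realType) (mu : probability T R).
Variable lambda : R.
Hypothesis lambda_ge1 : 1 <= lambda.
Implicit Types (u h A : T -> R).
Local Notation Lfun_ := (scaled_Lfun mu lambda).
Local Notation norm_ := (scaled_norm mu lambda).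

(** The continuity of superposition operators in the borderline case, where
    the growth of order [t] is the largest that index [t] allows, so that
    no room is left in Hoelder's inequality. The second bound says that [h]
    vanishes with [u]. Points are separated according to whether A > K, where
    the norm of A is small, or A <= K and |u| <= del, where [h] is uniformly
    small, or A <= K and |u| > del, where A is at most a multiple of |u|. *)
Lemma superposition_small (t : R) A (C e : R) : 0 < t <= lambda ->
  (forall x, 1 <= A x) -> Lfun_ 1 A -> 0 < C -> 0 < e ->
  exists2 eta, 0 < eta & forall h u, measurable_fun setT h -> Lfun_ 1 u ->
    (forall x, `|h x| <= C * (A x + `|u x|) `^ t) ->
    (forall x, `|h x| <= C * (A x + `|u x|) ^+ 2 * `|u x|) ->
    norm_ 1 u < eta -> Lfun_ t h /\ norm_ t h <= e.
Proof.
move=> tl A1 LA C0 e0; have /andP[t0 _] := tl.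
have A0 x : 0 <= A x by rewrite (le_trans ler01).
have l1 : 0 < (1 : R) <= lambda by rewrite ltr01.
(* The norm of the dominating function v must not exceed this threshold. *)
pose c := (e / (2 * C)) `^ t^-1.
have c0 : 0 < c by rewrite powR_gt0// divr_gt0// mulr_gt0.
have ct : C * c `^ t = e / 2.
  rewrite /c -powRrM mulVf ?gt_eqF// powRr1; last first.
    by rewrite ltW// divr_gt0// mulr_gt0.
  by field; rewrite gt_eqF.
have [K K0 [LK NK]] :=
  scaled_norm_truncation lambda_ge1 A0 LA (divr_gt0 c0 (ltr0n R 2)).
pose del := Num.min 1 (e / (2 * C * (K + 1) ^+ 2)).
have del0 : 0 < del.
  have K10 : 0 < K + 1 by rewrite addr_gt0.
  by rewrite lt_min ltr01 divr_gt0// !mulr_gt0// exprn_gt0.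
have del1 : del <= 1 by rewrite ge_min lexx.
have dele : C * (K + 1) ^+ 2 * del <= e / 2.
  have P0 : 0 < C * (K + 1) ^+ 2 by rewrite mulr_gt0// exprn_gt0// addr_gt0.
  rewrite -ler_pdivlMl// ge_min; apply/orP; right.
  rewrite le_eqVlt; apply/orP; left; apply/eqP; field.
  by rewrite !gt_eqF// addr_gt0.
(* Where A <= K and |u| > del, one has A + |u| <= (K / del + 1) |u|. *)
pose M := K / del + 1; have M1 : 1 <= M by rewrite lerDr divr_ge0// ltW.
have M0 : 0 < M := lt_le_trans ltr01 M1.
exists (c / 2 / M) => [|h u mh Lu hC hC2 ue]; first by rewrite !divr_gt0.
have mu_ := measurable_scaled_Lfun Lu.
have [Lnu nu] := scaled_Lfun_normr lambda_ge1 ltr01 Lu.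
have [LMu Mu] := scaled_LfunZ M l1 Lnu.
pose v := (A \* \1_[set x | K < A x]) \+ (fun x => M * `|u x|).
have [Lv Nv] : Lfun_ 1 v /\ norm_ 1 v <= c.
  have [Lv Nv] := scaled_LfunD l1 LK LMu.
  split=> //; rewrite (le_trans Nv)// [leRHS]splitr lerD// Mu ger0_norm ?ltW//.
  by rewrite -ltr_pdivlMl// mulrC (le_lt_trans nu).
have v0 x : 0 <= v x.
  by rewrite addr_ge0// mulr_ge0// ?ltW// indicE.
have [Lvt Nvt] := scaled_powR lambda_ge1 t0 v0 Lv.
have [LCv NCv] := scaled_LfunZ C tl Lvt.
have Le := scaled_Lfun_cst mu lambda t (e / 2).
have [Lb Nb] := scaled_LfunD tl Le LCv.
have e20 : 0 <= e / 2 by rewrite ltW// divr_gt0.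
have [|Lh Nh] := le_scaled_norm lambda_ge1 t0 Lb mh.
  move=> x; rewrite /= [leRHS]ger0_norm; last first.
    by rewrite addr_ge0// mulr_ge0 ?powR_ge0// ltW.
  have pt a b : 0 <= a -> a <= b -> C * a `^ t <= C * b `^ t.
    move=> a0 ab; rewrite ler_pM2l// ge0_ler_powR ?nnegrE ?(ltW t0)//.
    exact: le_trans ab.
  have [KA|AK] := ltP K (A x).
    rewrite (le_trans (hC x))// -[leLHS]add0r lerD// pt ?addr_ge0//.
    by rewrite /v /= indicE mem_set// mulr1 lerD2l ler_peMl.
  have [ud|du] := leP `|u x| del.
    rewrite (le_trans (hC2 x))// -[leLHS]addr0 lerD//; last first.
      by rewrite mulr_ge0 ?powR_ge0// ltW.
    rewrite (le_trans _ dele)// ler_pM//.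
      by rewrite mulr_ge0 ?exprn_ge0 ?addr_ge0// ltW.
    rewrite ler_pM2l// lerXn2r ?nnegrE ?addr_ge0 ?(ltW K0)//.
    by rewrite lerD// (le_trans ud).
  rewrite (le_trans (hC x))// -[leLHS]add0r lerD// pt ?addr_ge0//.
  rewrite /v /= -[leLHS]add0r lerD//; first by rewrite mulr_ge0// indicE.
  rewrite /M mulrDl mul1r lerD2r (le_trans AK)//.
  by rewrite mulrAC ler_pdivlMr// ler_pM2l// ltW.
split=> //; rewrite (le_trans Nh)// (le_trans Nb)// scaled_norm_cst//.
rewrite [leRHS]splitr lerD//; first by rewrite ger0_norm.
rewrite NCv gtr0_norm// Nvt -ct ler_pM2l// ge0_ler_powR ?nnegrE ?(ltW t0)//.
  exact: scaled_norm_ge0.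
exact: ltW.
Qed.

End Superposition.

(** * Multilinear operators given by multiplication *)

Section BoundedOperators.
Context d (T : measurableType d) (R : realType) (mu : probability T R).
Context (lambda : R) (lambda2 : 2 <= lambda).
Local Notation Lfun_ := (scaled_Lfun mu lambda).
Local Notation norm_ := (scaled_norm mu lambda).
Local Notation X := (model_space mu lambda2).
Implicit Types (f g h : T -> R) (s : R) (W : normedModType R).

Let lambda_ge1 : 1 <= lambda.
Proof. by rewrite (le_trans _ lambda2)// ler1n. Qed.

Let lambda_gt0 : 0 < lambda. Proof. exact: lt_le_trans ltr01 _. Qed.

Let one_le : 0 < (1 : R) <= lambda. Proof. by rewrite ltr01. Qed.

(** All estimates are made on functions; an element of the model space enters
    through its chosen representative. *)
Definition model_repr (v : X) : T -> R := Lrepr v.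

Lemma scaled_Lfun_repr (v : X) : Lfun_ 1 (model_repr v).
Proof. by rewrite /scaled_Lfun divr1; exact: LfunP. Qed.

Lemma measurable_repr (v : X) : measurable_fun setT (model_repr v).
Proof. exact: measurable_scaled_Lfun (scaled_Lfun_repr v). Qed.

Lemma model_normE (v : X) : `|v| = norm_ 1 (model_repr v).
Proof. by rewrite -{1}(LreprK v) Lspace_normE /scaled_norm divr1. Qed.

Lemma repr_linear (a : R) (u v : X) :
  model_repr (a *: u + v) =
    (fun x => a * model_repr u x + model_repr v x) %[ae mu].
Proof.
rewrite -[X in _ *: X + _]LreprK -[X in _ + X]LreprK LspaceZ LspaceD.
exact: Lclass_ae.
Qed.

Lemma reprD (u v : X) :
  model_repr (u + v) = model_repr u \+ model_repr v %[ae mu].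
Proof.
have := repr_linear 1 u v; rewrite scale1r.
by apply: filterS => x /[apply]; rewrite mul1r.
Qed.

(** Linear contractions on the space of index [s], defined on functions rather
    than on classes: only values at functions of index [s] matter. *)
Definition scaled_bounded s W (B : (T -> R) -> W) :=
  (forall c f g, Lfun_ s f -> Lfun_ s g ->
    B (fun x => c * f x + g x) = c *: B f + B g) /\
  (forall f, Lfun_ s f -> `|B f| <= norm_ s f).

Section Lift.
Variables (s : R) (W : normedModType R) (B : (T -> R) -> W).
Hypotheses (sl : 0 < s <= lambda) (bB : scaled_bounded s B).

Lemma scaled_bounded_dist f g : Lfun_ s f -> Lfun_ s g ->
  `|B f - B g| <= norm_ s (f \- g).
Proof.
move=> Lf Lg; have [linB leB] := bB.
rewrite -[B f - _]addrC -scaleN1r -linB//.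
rewrite (_ : (fun x => _) = f \- g); last first.
  by apply/funext => x /=; rewrite mulN1r addrC.
by apply: leB; exact: scaled_LfunB.
Qed.

(** Boundedness alone makes the operator insensitive to null sets. *)
Lemma scaled_bounded_ae f g : Lfun_ s f -> Lfun_ s g -> f = g %[ae mu] ->
  B f = B g.
Proof.
move=> Lf Lg fg; have /andP[s0 _] := sl.
apply/eqP; rewrite -subr_eq0 -normr_le0.
rewrite (le_trans (scaled_bounded_dist Lf Lg))//.
have mf := measurable_scaled_Lfun Lf; have mg := measurable_scaled_Lfun Lg.
rewrite (@scaled_norm_ae _ _ _ _ _ lambda_ge1 s _ (cst 0))//.
- by rewrite scaled_norm_cst// normr0.
- exact: measurable_funB.
- by apply: filterS fg => x /[apply] /= ->; rewrite subrr.
Qed.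

(** One more argument: a function [h] of index [s - 1] acts on the model space
    by multiplication followed by [B]. Iterating from the integral gives the
    multilinear form whose value at v1, ..., vn is the integral of
    h * v1 * ... * vn, the shape of all derivatives considered here. *)
Definition lift_operator h : clin X W :=
  insubd 0 (fun v : X => B (h \* model_repr v)).

Hypothesis s1 : 1 < s.

Let sl1 : 1 < s <= lambda. Proof. by case/andP: sl => _ ->; rewrite s1. Qed.

Let lift_clinear h : Lfun_ (s - 1) h ->
  (fun v : X => B (h \* model_repr v)) \in clinear.
Proof.
move=> Lh.
have Lhv v := (scaled_hoelder lambda_ge1 sl1 Lh (scaled_Lfun_repr v)).1.
have [linB leB] := bB.
have lin : linear (fun v : X => B (h \* model_repr v)).
  move=> a u v; rewrite -linB//; apply: scaled_bounded_ae => //.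
    have [Lahu _] := scaled_LfunZ a sl (Lhv u).
    exact: (scaled_LfunD sl Lahu (Lhv v)).1.
  apply: filterS (repr_linear a u v) => x /[apply] /= ->.
  by rewrite mulrDr mulrCA.
apply/clinearP; split=> //.
pose g : {linear X -> W} := HB.pack (fun v : X => B (h \* model_repr v))
  (GRing.isLinear.Build R X W *:%R _ lin).
rewrite -[F in continuous F]/(g : X -> W).
apply/linear_bounded_continuous/linear_boundedP; near=> r => v.
rewrite (le_trans (leB _ (Lhv v)))//.
rewrite (le_trans (scaled_hoelder lambda_ge1 sl1 Lh (scaled_Lfun_repr v)).2)//.
by rewrite -model_normE ler_wpM2r//; near: r; exact: nbhs_pinfty_ge.
Unshelve. all: by end_near. Qed.

Lemma lift_operatorE h v : Lfun_ (s - 1) h ->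
  lift_operator h v = B (h \* model_repr v).
Proof.
move=> /lift_clinear Lh.
by rewrite -[LHS]/(val (lift_operator h) v) val_insubd Lh.
Qed.

(** The operator norm of [lift_operator h] is controlled by Hoelder's
    inequality, so the construction can be repeated while the index stays
    positive. *)
Lemma lift_bounded : scaled_bounded (s - 1) lift_operator.
Proof.
have [linB leB] := bB; have /andP[s0 sle] := sl.
have sl' : 0 < s - 1 <= lambda.
  by rewrite subr_gt0 s1 (le_trans _ sle)// gerBl.
split=> [c f g Lf Lg|f Lf].
  apply/val_inj/funext => v.
  rewrite -[RHS]/(c *: lift_operator f v + lift_operator g v).
  rewrite -[LHS]/(lift_operator _ v) !lift_operatorE//; last first.
    have [Lcf _] := scaled_LfunZ c sl' Lf.
    exact: (scaled_LfunD sl' Lcf Lg).1.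
  have Lv := scaled_Lfun_repr v.
  rewrite -linB.
  - by congr B; apply/funext => x /=; rewrite mulrDl mulrA.
  - exact: (scaled_hoelder lambda_ge1 sl1 Lf Lv).1.
  - exact: (scaled_hoelder lambda_ge1 sl1 Lg Lv).1.
apply: opnorm_le => v v1; rewrite lift_operatorE//.
have [Lfv le] := scaled_hoelder lambda_ge1 sl1 Lf (scaled_Lfun_repr v).
rewrite (le_trans (leB _ Lfv))// (le_trans le)// -model_normE.
by rewrite ler_piMr// scaled_norm_ge0.
Qed.

End Lift.

End BoundedOperators.

(** * Differentiability of superposition *)

Section OperatorCalculus.
Context d (T : measurableType d) (R : realType) (mu : probability T R).
Context (lambda : R) (lambda2 : 2 <= lambda).
Local Notation Lfun_ := (scaled_Lfun mu lambda).
Local Notation norm_ := (scaled_norm mu lambda).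
Local Notation X := (model_space mu lambda2).
Local Notation lift := (lift_operator mu lambda2).
Local Notation bounded := (scaled_bounded mu lambda).

Let lambda_ge1 : 1 <= lambda.
Proof. by rewrite (le_trans _ lambda2)// ler1n. Qed.

Let lambda_gt0 : 0 < lambda. Proof. exact: lt_le_trans ltr01 _. Qed.

Let one_le : 0 < (1 : R) <= lambda. Proof. by rewrite ltr01. Qed.

Lemma Rintegral_bounded :
  bounded lambda (fun f : T -> R => (\int[mu]_x f x)%R : R).
Proof.
have ll : 0 < lambda <= lambda by rewrite lambda_gt0 lexx.
split=> [c f g Lf Lg|f]; last exact: le_Rintegral_scaled_norm.
have [Lcf _] := scaled_LfunZ c ll Lf.
have i1 := (scaled_Lfun_integrable mu lambda_ge1 _).1 Lcf.
have i2 := (scaled_Lfun_integrable mu lambda_ge1 _).1 Lf.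
have i3 := (scaled_Lfun_integrable mu lambda_ge1 _).1 Lg.
by rewrite RintegralD// RintegralZl.
Qed.

Fixpoint iter_lift {W : normedModType R} (B : (T -> R) -> W) n :
    (T -> R) -> clinn X W n :=
  match n return (T -> R) -> clinn X W n with
  | 0 => B
  | n'.+1 => lift (iter_lift B n')
  end.

Lemma iter_lift_bounded (W : normedModType R) (B : (T -> R) -> W) (s : R) n :
  s <= lambda -> bounded s B -> n%:R < s -> bounded (s - n%:R) (iter_lift B n).
Proof.
move=> sl bB; elim: n => [|n IH] ns; first by rewrite subr0.
have n0 : 0 <= n%:R :> R by [].
rewrite -natr1 opprD addrA; apply: lift_bounded.
- rewrite subr_gt0 (lt_trans _ ns) ?ltr_nat//=.
  by rewrite (le_trans _ sl)// gerBl.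
- by apply: IH; apply: lt_trans ns; rewrite ltr_nat.
- by rewrite ltrBrDr nat1r.
Qed.

Section Derivative.
Variables (s : R) (W : normedModType R) (B : (T -> R) -> W).
Hypotheses (sl : 1 < s <= lambda) (bB : bounded s B).
Variables (phi0 phi1 phi2 : T -> R -> R) (beta : T -> R) (C : R).
Hypothesis phi0_derive : forall w (y : R), is_derive y 1 (phi0 w) (phi1 w y).
Hypothesis phi1_derive : forall w (y : R), is_derive y 1 (phi1 w) (phi2 w y).
Hypothesis phi0_Lfun : forall u, Lfun_ 1 u -> Lfun_ s (fun w => phi0 w (u w)).
Hypothesis phi1_measurable : forall u : T -> R, measurable_fun setT u ->
  measurable_fun setT (fun w => phi1 w (u w)).
Hypotheses (beta1 : forall w, 1 <= beta w) (Lbeta : Lfun_ 1 beta) (C0 : 0 < C).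
Hypothesis phi1_growth : forall w y,
  `|phi1 w y| <= C * (beta w + `|y|) `^ (s - 1).
Hypothesis phi2_growth : forall w y,
  `|phi2 w y| <= C * (beta w + `|y|) ^+ 2.

Let s0 : 0 < s. Proof. by case/andP: sl => /(lt_trans ltr01). Qed.

Let s10 : 0 < s - 1. Proof. by rewrite subr_gt0; case/andP: sl. Qed.

Let sl0 : 0 < s <= lambda. Proof. by rewrite s0; case/andP: sl. Qed.

Let sl' : 0 < s - 1 <= lambda.
Proof.
by rewrite s10; case/andP: sl => _ /(le_trans _); apply; rewrite gerBl.
Qed.

Let G (u : X) := B (fun w => phi0 w (model_repr u w)).

Let remainder (a u : T -> R) w :=
  phi0 w (a w + u w) - phi0 w (a w) - phi1 w (a w) * u w.

Let beta_ge0 w : 0 <= beta w. Proof. exact: le_trans (beta1 w). Qed.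

Let phi1_Lfun a : Lfun_ 1 a -> Lfun_ (s - 1) (fun w => phi1 w (a w)).
Proof.
move=> La; have ma := measurable_scaled_Lfun La.
have [Lna _] := scaled_Lfun_normr lambda_ge1 ltr01 La.
have [Lb _] := scaled_LfunD one_le Lbeta Lna.
have [|Lp _] := scaled_powR lambda_ge1 s10 _ Lb.
  by move=> x /=; rewrite addr_ge0.
have [LCp _] := scaled_LfunZ C sl' Lp.
apply: (le_scaled_norm lambda_ge1 s10 LCp _ _).1 => [|w].
  exact: phi1_measurable.
by rewrite [leRHS]ger0_norm ?phi1_growth// mulr_ge0 ?powR_ge0// ltW.
Qed.

(** Dividing the Taylor remainder by the increment [u] leaves a function q of
    index [s - 1]: the bound on [phi1] controls its growth and the bound on
    [phi2] makes it vanish with [u], so that it is small in norm; Hoelder's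
    inequality restores the factor [u]. *)
Let remainder_small a (e : R) : Lfun_ 1 a -> 0 < e ->
  exists2 eta, 0 < eta & forall u, Lfun_ 1 u -> norm_ 1 u < eta ->
    Lfun_ s (remainder a u) /\ norm_ s (remainder a u) <= e * norm_ 1 u.
Proof.
move=> La e0; have ma := measurable_scaled_Lfun La.
have [Lna _] := scaled_Lfun_normr lambda_ge1 ltr01 La.
have [Lb _] := scaled_LfunD one_le Lbeta Lna.
have b1 w : 1 <= (beta \+ (fun x => `|a x|)) w.
  by rewrite /= (le_trans (beta1 w))// lerDl.
have C20 : 0 < 2 * C by rewrite mulr_gt0.
have [eta eta0 small] := superposition_small lambda_ge1 sl' b1 Lb C20 e0.
exists eta => // u Lu ue; have mu_ := measurable_scaled_Lfun Lu.
have Lau := (scaled_LfunD one_le La Lu).1.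
have mrem : measurable_fun setT (remainder a u).
  apply: measurable_funB; last first.
    by apply: measurable_funM => //; exact: phi1_measurable.
  apply: measurable_funB; exact: measurable_scaled_Lfun (phi0_Lfun _).
pose q w := remainder a u w / u w.
have bound w c : `|c| <= `|a w| + `|u w| ->
    C * (beta w + `|c|) `^ (s - 1) <=
    C * ((beta \+ (fun x => `|a x|)) w + `|u w|) `^ (s - 1).
  move=> cw; rewrite ler_pM2l// ge0_ler_powR ?nnegrE ?(ltW s10) ?addr_ge0//.
  by rewrite /= -addrA lerD2l.
(* Where u vanishes, the quotient by u is 0 and all bounds are trivial. *)
have [||||Lq Nq] := small q u _ Lu.
- apply: measurable_funM => //.
  exact: (measurableT_comp (@measurable_fun_inv R)).
- move=> w; rewrite /q /remainder.
  have [uw0|uw0] := eqVneq (u w) 0.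
    by rewrite uw0 invr0 mulr0 normr0 mulr_ge0 ?powR_ge0// ltW.
  have [c [cw _ ->]] := mean_value (a w) (u w) (phi0_derive w).
  rewrite -mulrBl mulfK// (le_trans (ler_normB _ _))//.
  rewrite -mulrA mulr_natl mulr2n lerD// (le_trans (phi1_growth _ _))// bound//.
  by rewrite lerDl.
- move=> w; rewrite /q /remainder.
  have [uw0|uw0] := eqVneq (u w) 0.
    by rewrite uw0 invr0 mulr0 normr0 mulr0.
  have [c [cw cu ->]] := mean_value (a w) (u w) (phi0_derive w).
  rewrite -mulrBl mulfK//.
  have [c' [cw' _ E]] := mean_value (a w) (c - a w) (phi1_derive w).
  rewrite subrKC in E; rewrite E normrM ler_pM//.
  rewrite (le_trans (phi2_growth _ _))//.
  rewrite ler_pM ?(ltW C0) ?exprn_ge0 ?addr_ge0//.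
    by rewrite ler_peMl ?ler1n// ltW.
  rewrite lerXn2r ?nnegrE ?addr_ge0//.
  by rewrite /= -addrA lerD2l (le_trans cw')// lerD2l.
- exact: ue.
have qE : remainder a u = q \* u.
  apply/funext => w; rewrite /q /=; have [uw0|uw0] := eqVneq (u w) 0.
    by rewrite /remainder uw0 addr0 subrr !mulr0 subr0.
  by rewrite divfK.
have [Lr Nr] := scaled_hoelder lambda_ge1 sl Lq Lu.
rewrite qE; split=> //; rewrite (le_trans Nr)//.
by rewrite ler_wpM2r// scaled_norm_ge0.
Qed.

(** Superposition with [phi0] followed by [B] is differentiable at every point
    because the Taylor remainder is o(|v|) in the norm of index [s], on which
    [B] is a contraction. The derivative multiplies by [phi1], hence is the
    lift of [B]. *)
Lemma superposition_diff (a : X) :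
  differentiable (fun u : X => B (fun w => phi0 w (model_repr u w))) a /\
  'd (fun u : X => B (fun w => phi0 w (model_repr u w))) a =
    lift B (fun w => phi1 w (model_repr a w)) :> (X -> W).
Proof.
rewrite -/G; set df := lift B _.
have Lrep (v : X) : Lfun_ 1 (model_repr v) := scaled_Lfun_repr v.
have dfE v : df v = B ((fun w => phi1 w (model_repr a w)) \* model_repr v).
  by apply: (lift_operatorE sl0 bB); [case/andP: sl|exact: phi1_Lfun].
have [ldf cdf] := clinP df.
pose g : {linear X -> W} :=
  HB.pack (df : X -> W) (GRing.isLinear.Build R X W *:%R _ ldf).
have GE : G \o shift a = cst (G a) + g +o_ 0 id.
  apply/eqaddoP => e e0.
  have [eta eta0 small] := remainder_small (Lrep a) e0.
  have : \forall v \near (0 : X), `|v| < eta.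
    exact: nbhs0_lt.
  apply: filterS => v; rewrite model_normE => veta.
  have [Lr Nr] := small (model_repr v) (Lrep v) veta.
  have Lav := (scaled_LfunD one_le (Lrep a) (Lrep v)).1.
  have E1 : G (v + a) = B (fun w => phi0 w (model_repr a w + model_repr v w)).
    apply: (scaled_bounded_ae lambda2 sl0 bB).
    - exact: phi0_Lfun.
    - exact: (phi0_Lfun Lav).
    - apply: filterS (reprD v a) => w /[apply] /= ->; by rewrite addrC.
  have Lp0a := phi0_Lfun (Lrep a); have Lp0av := phi0_Lfun Lav.
  have Ldf := (scaled_hoelder lambda_ge1 sl (phi1_Lfun (Lrep a)) (Lrep v)).1.
  have [linB leB] := bB.
  have E2 : G (v + a) - (G a + df v) =
      B (remainder (model_repr a) (model_repr v)).
    rewrite E1 dfE.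
    have -> : remainder (model_repr a) (model_repr v) = (fun w =>
        (-1) * (phi0 w (model_repr a w) +
                phi1 w (model_repr a w) * model_repr v w) +
        phi0 w (model_repr a w + model_repr v w)).
      by apply/funext => w; rewrite /remainder mulN1r opprD -addrA addrC.
    rewrite linB//; last exact: (scaled_LfunD sl0 Lp0a Ldf).1.
    rewrite scaleN1r addrC; congr (- _ + _).
    rewrite -[G a]scale1r -linB//; congr B.
    by apply/funext => w /=; rewrite mul1r.
  rewrite -[(_ - _) v]/(G (v + a) - (G a + df v)) E2.
  exact: le_trans (leB _ Lr) Nr.
have dG : 'd G a = g :> (X -> W) .
  exact: (@diff_unique R X W G g a cdf GE).
by split=> //; apply/diff_locallyP; rewrite dG; split.
Qed.

End Derivative.

End OperatorCalculus.

(** * Mixed partial derivatives of integral functionals *)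

Section SymbolFamily.
Context {R : realType}.

(** Growth is quadratic for the integrand itself, linear once one of the
    variables has been differentiated, and disappears once both have. *)
Definition family_order (i j : nat) : nat := (i == 0%N) + (j == 0%N).

(** [g i j] is the derivative of order [i] in the first variable and [j] in the
    second one of [g 0 0]. *)
Definition symbol_family (g : nat -> nat -> R -> R -> R) :=
  [/\ forall i j y (x : R), is_derive x 1 (g i j ^~ y) (g i.+1 j x y),
      forall i j x (y : R), is_derive y 1 (g i j x) (g i j.+1 x y),
      forall i j, exists2 C : R, 0 < C & forall x y,
        `|g i j x y| <= C * (1 + `|x| + `|y|) ^+ family_order i j &
      forall d (T : measurableType d) i j (a b : T -> R),
        measurable_fun setT a -> measurable_fun setT b ->
        measurable_fun setT (fun w => g i j (a w) (b w))].

Lemma family_order_le2 i j : (family_order i j <= 2)%N.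
Proof. by case: i => [|i]; case: j. Qed.

Lemma symbol_family_growth2 g i j : symbol_family g ->
  exists2 C : R, 0 < C & forall x y, `|g i j x y| <= C * (1 + `|x| + `|y|) ^+ 2.
Proof.
case=> _ _ /(_ i j)[C C0 gC] _; exists C => // x y.
rewrite (le_trans (gC x y))// ler_pM2l// ler_weXn2l ?family_order_le2//.
by rewrite -addrA lerDl addr_ge0.
Qed.

Lemma symbol_family_dist g i j : symbol_family g ->
  exists2 C : R, 0 < C & forall x y u v : R,
    `|g i j (x + u) (y + v) - g i j x y| <=
    C * (1 + `|x| + `|y| + (`|u| + `|v|)) ^+ 2 * (`|u| + `|v|).
Proof.
move=> sg; have [d1 d2 _ _] := sg.
have [C1 C10 g1] := symbol_family_growth2 i.+1 j sg.
have [C2 C20 g2] := symbol_family_growth2 i j.+1 sg.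
exists (C1 + C2) => [|x y u v]; first exact: addr_gt0.
set K := 1 + _ + _ + _.
have [c [cx _ E1]] := mean_value x u (d1 i j (y + v)).
have [c' [cy _ E2]] := mean_value y v (d2 i j x).
rewrite (_ : _ - _ = (g i j (x + u) (y + v) - g i j x (y + v)) +
  (g i j x (y + v) - g i j x y)); last by rewrite addrA subrK.
rewrite E1 E2 (le_trans (ler_normD _ _))// !normrM.
have yv : `|y + v| <= `|y| + `|v| := ler_normD _ _.
have u0 := normr_ge0 u; have v0 := normr_ge0 v; have x0 := normr_ge0 x.
have y0 := normr_ge0 y.
have h1 : `|g i.+1 j c (y + v)| <= C1 * K ^+ 2.
  rewrite (le_trans (g1 _ _))// ler_pM2l// lerXn2r ?nnegrE ?addr_ge0//.
  by rewrite /K; lra.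
have h2 : `|g i j.+1 x c'| <= C2 * K ^+ 2.
  rewrite (le_trans (g2 _ _))// ler_pM2l// lerXn2r ?nnegrE ?addr_ge0//.
  by rewrite /K; lra.
have P1 : 0 <= C1 * K ^+ 2 := le_trans (normr_ge0 _) h1.
have P2 : 0 <= C2 * K ^+ 2 := le_trans (normr_ge0 _) h2.
rewrite mulrDl [leRHS]mulrDl lerD// ler_pM//; by rewrite ?lerDl ?lerDr.
Qed.

End SymbolFamily.

Section MixedPartials.
Context d (T : measurableType d) (R : realType) (mu : probability T R).
Context (lambda : R) (lambda2 : 2 <= lambda).
Local Notation Lfun_ := (scaled_Lfun mu lambda).
Local Notation norm_ := (scaled_norm mu lambda).
Local Notation X := (model_space mu lambda2).
Local Notation bounded := (scaled_bounded mu lambda).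

Let lambda_ge1 : 1 <= lambda.
Proof. by rewrite (le_trans _ lambda2)// ler1n. Qed.

Let lambda_gt0 : 0 < lambda. Proof. exact: lt_le_trans ltr01 _. Qed.

Let one_le : 0 < (1 : R) <= lambda. Proof. by rewrite ltr01. Qed.

(** The number of directions is less than lambda, so that the coefficient has
    a finite exponent lambda / (lambda - i - j), and its growth is one that
    this exponent allows for functions in the model space. *)
Definition admissible i j :=
  (i + j)%:R < lambda /\ (family_order i j + i + j)%:R <= lambda.

Lemma admissibleS1 i j : admissible i.+1 j -> admissible i j.
Proof.
move=> [h1 h2]; split.
  by apply: le_lt_trans h1; rewrite ler_nat addSn.
apply: le_trans h2; rewrite ler_nat /family_order.
by case: (i) => [|k] //=; case: (j) => [|l] /=; lia.
Qed.

Lemma admissibleS2 i j : admissible i j.+1 -> admissible i j.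
Proof.
move=> [h1 h2]; split.
  by apply: le_lt_trans h1; rewrite ler_nat addnS.
apply: le_trans h2; rewrite ler_nat /family_order.
by case: (i) => [|k] //=; case: (j) => [|l] /=; lia.
Qed.

Lemma admissibleW i j i' j' : (i' <= i)%N -> (j' <= j)%N ->
  admissible i j -> admissible i' j'.
Proof.
move=> /subnK <- /subnK <-.
elim: (i - i')%N => [|n IH]; last by rewrite addSn => /admissibleS1.
rewrite add0n; elim: (j - j')%N => [|n IH]; first by rewrite add0n.
by rewrite addSn => /admissibleS2.
Qed.

Variable g : nat -> nat -> R -> R -> R.
Hypothesis sg : symbol_family g.

Let order_left i j : R := lambda - (j%:R) - (i%:R).

Let order_left_itv i j : admissible i j -> 0 < order_left i j <= lambda.
Proof.
rewrite /admissible /order_left natrD => -[h1 _].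
have i0 : 0 <= i%:R :> R by []. have j0 : 0 <= j%:R :> R by [].
by apply/andP; split; lra.
Qed.

Let norm_Lfun a := @scaled_Lfun_normr _ T R mu lambda lambda_ge1 1 a ltr01.

Let weight (a b : T -> R) w := 1 + `|a w| + `|b w|.

Let weight_ge1 a b w : 1 <= weight a b w.
Proof. by rewrite /weight -addrA lerDl addr_ge0. Qed.

Let weight_Lfun a b : Lfun_ 1 a -> Lfun_ 1 b -> Lfun_ 1 (weight a b).
Proof.
move=> /norm_Lfun[La _] /norm_Lfun[Lb _].
have L1 := scaled_Lfun_cst mu lambda 1 1.
exact: (scaled_LfunD one_le (scaled_LfunD one_le L1 La).1 Lb).1.
Qed.

(** The first condition of admissibility makes the order lambda - i - j
    positive, the second one makes it at least [family_order i j]. *)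
Let growth i j : admissible i j -> exists2 C : R, 0 < C & forall x y : R,
  `|g i j x y| <= C * (1 + `|x| + `|y|) `^ order_left i j.
Proof.
move=> adm; have [_ _ /(_ i j)[C C0 gC] _] := sg; exists C => // x y.
have K1 : 1 <= 1 + `|x| + `|y| by rewrite -addrA lerDl addr_ge0.
rewrite (le_trans (gC x y))// ler_pM2l// -powR_mulrn ?(le_trans ler01)//.
rewrite ler_powR//; have [_] := adm; rewrite /order_left !natrD; lra.
Qed.

Lemma symbol_family_Lfun i j a b : admissible i j -> Lfun_ 1 a -> Lfun_ 1 b ->
  Lfun_ (lambda - j%:R - i%:R) (fun w => g i j (a w) (b w)).
Proof.
move=> adm La Lb; have sl := order_left_itv adm.
have /andP[s0 _] := sl.
have [C C0 gC] := growth adm; have [_ _ _ mg] := sg.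
have [|Lp _] := scaled_powR lambda_ge1 s0 _ (weight_Lfun La Lb).
  by move=> x; rewrite (le_trans ler01).
have [LCp _] := scaled_LfunZ C sl Lp.
apply: (le_scaled_norm lambda_ge1 s0 LCp _ _).1 => [|w].
  by apply: mg;
    [exact: measurable_scaled_Lfun La|exact: measurable_scaled_Lfun Lb].
by rewrite [leRHS]ger0_norm ?gC// mulr_ge0 ?powR_ge0// ltW.
Qed.

Let Rint (f : T -> R) : R := \int[mu]_x f x.

(** The nesting follows the order of differentiation: the [j] derivatives in
    the second variable are taken first. *)
Definition family_operator i j : (T -> R) -> clinn X (clinn X R j) i :=
  iter_lift mu lambda2 (iter_lift mu lambda2 Rint j) i.

Let family_operator_bounded i j : admissible i j ->
  bounded (lambda - j%:R - i%:R) (family_operator i j).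
Proof.
move=> adm; have := adm; rewrite /admissible natrD => -[ij _].
have i0 : 0 <= i%:R :> R by []. have j0 : 0 <= j%:R :> R by [].
apply: iter_lift_bounded; first lra; last lra.
apply: iter_lift_bounded => //; last lra.
exact: Rintegral_bounded.
Qed.

Definition family_map i j (ab : X * X) : clinn X (clinn X R j) i :=
  family_operator i j (fun w => g i j (model_repr ab.1 w) (model_repr ab.2 w)).

(** Here and in [family_map_diff2] the other variable is frozen, and its
    absolute value becomes part of the weight in the growth bounds. *)
Lemma family_map_diff1 i j (ab : X * X) : admissible i.+1 j ->
  differentiable (fun u : X => family_map i j (u, ab.2)) ab.1 /\
  partial1 (family_map i j) ab = family_map i.+1 j ab.
Proof.
move=> adm1; have adm := admissibleS1 adm1.
have [d1 d2 _ mg] := sg; case: ab => a b /=.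
have La := scaled_Lfun_repr a; have Lb := scaled_Lfun_repr b.
have mb := measurable_repr b.
have s1E : order_left i.+1 j = order_left i j - 1.
  by rewrite /order_left -natr1 opprD addrA.
have sl : 1 < order_left i j <= lambda.
  have /andP[+ _] := order_left_itv adm1; rewrite s1E subr_gt0 => ->.
  by have /andP[_ ->] := order_left_itv adm.
have [C1 C10 g1] := growth adm1.
have [C2 C20 g2] := symbol_family_growth2 i.+2 j sg.
have C0 : 0 < C1 + C2 by exact: addr_gt0.
have Lbeta : Lfun_ 1 (fun w => 1 + `|model_repr b w|).
  have L1 := scaled_Lfun_cst mu lambda 1 1.
  exact: (scaled_LfunD one_le L1 (norm_Lfun Lb).1).1.
have E w y : 1 + `|model_repr b w| + `|y| = 1 + `|y| + `|model_repr b w|.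
  by rewrite addrAC.
have [|||dG dGE] := @superposition_diff _ T R mu lambda lambda2
  (order_left i j) _ (family_operator i j) sl (family_operator_bounded adm)
  (fun w x => g i j x (model_repr b w)) (fun w x => g i.+1 j x (model_repr b w))
  (fun w x => g i.+2 j x (model_repr b w))
  (fun w => 1 + `|model_repr b w|) (C1 + C2)
  (fun w x => d1 i j (model_repr b w) x)
  (fun w x => d1 i.+1 j (model_repr b w) x)
  (fun u Lu => symbol_family_Lfun adm Lu Lb)
  (fun u mu_ => mg _ _ i.+1 j _ _ mu_ mb)
  _ Lbeta C0 _ _ a.
- by move=> w; rewrite lerDl.
- move=> w y; rewrite -s1E E (le_trans (g1 _ _))// ler_wpM2r ?powR_ge0//.
  by rewrite lerDl ltW.
- move=> w y; rewrite E (le_trans (g2 _ _))// ler_wpM2r ?exprn_ge0 ?addr_ge0//.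
  by rewrite lerDr ltW.
split=> //; rewrite /partial1 /= dGE.
exact: valKd.
Qed.

Lemma family_map_diff2 j (ab : X * X) : admissible 0 j.+1 ->
  differentiable (fun v : X => family_map 0 j (ab.1, v) : clinn X R j) ab.2 /\
  partial2 (family_map 0 j : X * X -> clinn X R j) ab = family_map 0 j.+1 ab.
Proof.
move=> adm1; have adm := admissibleS2 adm1.
have [d1 d2 _ mg] := sg; case: ab => a b /=.
have La := scaled_Lfun_repr a; have Lb := scaled_Lfun_repr b.
have ma := measurable_repr a.
have s1E : order_left 0 j.+1 = order_left 0 j - 1.
  by rewrite /order_left -natr1; ring.
have sl : 1 < order_left 0 j <= lambda.
  have /andP[+ _] := order_left_itv adm1; rewrite s1E subr_gt0 => ->.
  by have /andP[_ ->] := order_left_itv adm.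
have [C1 C10 g1] := growth adm1.
have [C2 C20 g2] := symbol_family_growth2 0 j.+2 sg.
have C0 : 0 < C1 + C2 by exact: addr_gt0.
have Lbeta : Lfun_ 1 (fun w => 1 + `|model_repr a w|).
  have L1 := scaled_Lfun_cst mu lambda 1 1.
  exact: (scaled_LfunD one_le L1 (norm_Lfun La).1).1.
have [|||dG dGE] := @superposition_diff _ T R mu lambda lambda2
  (order_left 0 j) _ (family_operator 0 j) sl (family_operator_bounded adm)
  (fun w => g 0 j (model_repr a w)) (fun w => g 0 j.+1 (model_repr a w))
  (fun w => g 0 j.+2 (model_repr a w))
  (fun w => 1 + `|model_repr a w|) (C1 + C2)
  (fun w y => d2 0 j (model_repr a w) y)
  (fun w y => d2 0 j.+1 (model_repr a w) y)
  (fun u Lu => symbol_family_Lfun adm La Lu)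
  (fun u mu_ => mg _ _ 0 j.+1 _ _ ma mu_)
  _ Lbeta C0 _ _ b.
- by move=> w; rewrite lerDl.
- move=> w y; rewrite -s1E (le_trans (g1 _ _))// ler_wpM2r ?powR_ge0//.
  by rewrite lerDl ltW.
- move=> w y; rewrite (le_trans (g2 _ _))// ler_wpM2r ?exprn_ge0 ?addr_ge0//.
  by rewrite lerDr ltW.
split=> //; rewrite /partial2 /= dGE.
exact: valKd.
Qed.

(** The operator is a contraction from index lambda - i - j, and its argument
    is a superposition whose increment obeys the two bounds of
    [superposition_small]. *)
Lemma family_map_continuous i j : admissible i j -> continuous (family_map i j).
Proof.
move=> adm [a b]; have sl := order_left_itv adm; have [_ _ _ mg] := sg.
have La := scaled_Lfun_repr a; have Lb := scaled_Lfun_repr b.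
have [C1 C10 g1] := growth adm.
have [C2 C20 g2] := symbol_family_dist i j sg.
have C0 : 0 < 2 * C1 + C2 by rewrite addr_gt0// mulr_gt0.
apply/cvgrPdist_le => e e0.
have [eta eta0 small] := superposition_small lambda_ge1 sl
  (@weight_ge1 (model_repr a) (model_repr b)) (weight_Lfun La Lb) C0 e0.
have eta20 : 0 < eta / 2 by rewrite divr_gt0.
near=> z.
have za : `|z.1 - a| < eta / 2.
  rewrite distrC; near: z; apply: (@cvgr_dist_lt _ _ _ _ _ fst a) => //.
  exact: cvg_fst.
have zb : `|z.2 - b| < eta / 2.
  rewrite distrC; near: z; apply: (@cvgr_dist_lt _ _ _ _ _ snd b) => //.
  exact: cvg_snd.
have Lda := scaled_Lfun_repr (z.1 - a); have Ldb := scaled_Lfun_repr (z.2 - b).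
have Lz1 := scaled_Lfun_repr z.1; have Lz2 := scaled_Lfun_repr z.2.
have Lga := (scaled_LfunD one_le La Lda).1.
have Lgb := (scaled_LfunD one_le Lb Ldb).1.
have Lg' := symbol_family_Lfun adm Lga Lgb.
have Lg := symbol_family_Lfun adm La Lb.
have Lgz := symbol_family_Lfun adm Lz1 Lz2.
have bB := family_operator_bounded adm.
rewrite distrC /family_map /=.
have -> : family_operator i j
    (fun w => g i j (model_repr z.1 w) (model_repr z.2 w)) =
  family_operator i j (fun w => g i j (model_repr a w + model_repr (z.1 - a) w)
    (model_repr b w + model_repr (z.2 - b) w)).
  apply: (scaled_bounded_ae lambda2 sl bB) => //.
  have := reprD a (z.1 - a); have := reprD b (z.2 - b); rewrite !subrKC.
  by apply: filterS2 => w /(_ I) E2 /(_ I) E1 _; rewrite E1 E2.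
rewrite (le_trans (scaled_bounded_dist sl bB Lg' Lg))//.
have [Lna na] := norm_Lfun Lda; have [Lnb nb] := norm_Lfun Ldb.
have [Lu Nu] := scaled_LfunD one_le Lna Lnb.
have uw w : `| `|model_repr (z.1 - a) w| + `|model_repr (z.2 - b) w| | =
  `|model_repr (z.1 - a) w| + `|model_repr (z.2 - b) w|.
  by rewrite ger0_norm// addr_ge0.
apply: (small _ _ _ Lu _ _ _).2.
- by apply: measurable_funB; apply: measurable_scaled_Lfun;
    [exact: Lg'|exact: Lg].
- move=> w /=; rewrite uw /weight.
  have s0 : 0 <= order_left i j by case/andP: sl => /ltW.
  set a' := model_repr (z.1 - a) w; set b' := model_repr (z.2 - b) w.
  set K := _ + (_ + _).
  have K0 : 0 <= K by rewrite !addr_ge0.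
  have bound x y : 1 + `|x| + `|y| <= K ->
    `|g i j x y| <= C1 * K `^ order_left i j.
    move=> xyK; rewrite (le_trans (g1 _ _))// ler_pM2l//.
    by rewrite ge0_ler_powR// nnegrE !addr_ge0.
  rewrite (le_trans (ler_normB _ _))//.
  have h1 : `|g i j (model_repr a w + a') (model_repr b w + b')| <=
      C1 * K `^ order_left i j.
    apply: bound.
    by rewrite /K addrACA lerD ?ler_normD// -addrA lerD2l ler_normD.
  have h2 : `|g i j (model_repr a w) (model_repr b w)| <=
      C1 * K `^ order_left i j.
    by apply: bound; rewrite lerDl addr_ge0.
  have h3 : 0 <= C2 * K `^ order_left i j by rewrite mulr_ge0 ?powR_ge0 ?ltW.
  by rewrite mulrDl -mulrA mulr_natl mulr2n (le_trans (lerD h1 h2))// lerDl.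
- move=> w /=; rewrite uw /weight (le_trans (g2 _ _ _ _))//.
  rewrite ler_wpM2r ?addr_ge0// ler_wpM2r ?exprn_ge0 ?addr_ge0//.
  by rewrite lerDr mulr_ge0// ltW.
- rewrite (le_lt_trans Nu)// [ltRHS]splitr ltrD//.
    by rewrite (le_lt_trans na)// -model_normE.
  by rewrite (le_lt_trans nb)// -model_normE.
Unshelve. all: by end_near. Qed.

Lemma family_map_partial2n j : admissible 0 j ->
  partial2n j (family_map 0 0 : X * X -> R) = family_map 0 j /\
  forall k, (k < j)%N ->
    partially_differentiable2 (partial2n k (family_map 0 0 : X * X -> R)).
Proof.
elim: j => [//|j IH] adm1; have [E IHd] := IH (admissibleS2 adm1).
split=> [|k].
  rewrite [LHS]/(partial2 (partial2n j _)) E; apply/funext => ab.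
  exact: (family_map_diff2 ab adm1).2.
rewrite ltnS leq_eqVlt => /predU1P[->|/IHd//].
by rewrite E => ab; exact: (family_map_diff2 ab adm1).1.
Qed.

Lemma family_map_mixed_partial i j : admissible i j ->
  mixed_partial i j (family_map 0 0 : X * X -> R) = family_map i j /\
  forall k, (k < i)%N ->
    partially_differentiable1 (mixed_partial k j (family_map 0 0 : X * X -> R)).
Proof.
elim: i => [|i IH] adm1.
  by split=> //; exact: (family_map_partial2n adm1).1.
have [E IHd] := IH (admissibleS1 adm1); split=> [|k].
  rewrite [LHS]/(partial1 (mixed_partial i j _)) E; apply/funext => ab.
  exact: (family_map_diff1 ab adm1).2.
rewrite ltnS leq_eqVlt => /predU1P[->|/IHd//].
by rewrite E => ab; exact: (family_map_diff1 ab adm1).1.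
Qed.

Theorem family_map_class_C i j : admissible i j ->
  class_C i j (fun ab : X * X =>
    \int[mu]_w g 0 0 (model_repr ab.1 w) (model_repr ab.2 w) : R).
Proof.
move=> adm i' j' i'i j'j; have adm' := admissibleW i'i j'j adm.
have [E dE] := family_map_mixed_partial adm'.
split; last by rewrite [X in continuous X]E; exact: family_map_continuous.
split; last exact: dE.
exact: (family_map_partial2n (admissibleW (leq0n i') (leqnn j') adm')).2.
Qed.

End MixedPartials.

(** * Densities and the chart *)

Section Densities.
Context d (T : measurableType d) (R : realType) (mu : probability T R).
Local Notation fmeasure := {finite_measure set T -> \bar R}.
Implicit Types (P : fmeasure) (f : T -> R) (A : set T).

Lemma exists_weighted_measure f : (forall x, 0 <= f x) ->
  mu.-integrable setT (EFin \o f) ->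
  exists P, forall A, (P A = \int[mu]_(x in A) (f x)%:E)%E.
Proof.
move=> f0 intf; have mf := measurable_int _ intf.
have fE0 x : (0 <= (f x)%:E)%E by rewrite lee_fin.
pose nu A : \bar R := (\int[mu]_(x in A) (f x)%:E)%E.
have nu0 : nu set0 = 0%E by rewrite /nu integral_set0.
have nu_ge0 A : (0 <= nu A)%E by exact: integral_ge0.
have nu_sigma : semi_sigma_additive nu.
  move=> F mF tF mUF; rewrite /nu; apply: cvg_toP.
    apply: ereal_nondecreasing_is_cvgn => m n mn.
    by apply: lee_sum_nneg_natr => // k _ _; exact: integral_ge0.
  rewrite ge0_integral_bigcup//; exact: measurable_funTS.
pose nuM : {measure set T -> \bar R} :=
  HB.pack nu (isMeasure.Build _ _ _ nu nu0 nu_ge0 nu_sigma).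
have nu_fin : fin_num_fun nuM.
  move=> A mA; rewrite ge0_fin_numE//.
  have le : (nuM A <= nuM setT)%E by rewrite le_measure ?inE.
  apply: le_lt_trans le _; have /integrableP[_] := intf; apply: le_lt_trans.
  apply: ge0_le_integral => //= [|x _]; last by rewrite lee_fin ler_norm.
  by have := measurableT_comp (@abse_measurable R setT) mf; exact.
pose nuF : fmeasure := HB.pack nu (Measure.on nuM)
  (Measure_isFinite.Build _ _ _ nuM nu_fin).
by exists nuF.
Qed.

Section AbsolutelyContinuous.
Variable P : fmeasure.
Hypothesis Pmu : P `<< mu.

Let RN_fin x :
  Radon_Nikodym (charge_of_finite_measure P) mu x \is a fin_num.
Proof. exact: Radon_Nikodym_fin_num. Qed.

Lemma integrable_density : mu.-integrable setT (EFin \o density mu P).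
Proof.
rewrite (_ : _ \o _ = Radon_Nikodym (charge_of_finite_measure P) mu).
  exact: Radon_Nikodym_integrable.
by apply/funext => x; rewrite /density /= fineK.
Qed.

Lemma measurable_density : measurable_fun setT (density mu P).
Proof. exact/measurable_EFinP/(measurable_int _ integrable_density). Qed.

Lemma integral_density A : measurable A ->
  (\int[mu]_(x in A) (density mu P x)%:E = P A)%E.
Proof.
move=> mA; under eq_integral do rewrite /density fineK//.
by rewrite -Radon_Nikodym_integral.
Qed.

Lemma density_unique f : mu.-integrable setT (EFin \o f) ->
  (forall A, measurable A -> (P A = \int[mu]_(x in A) (f x)%:E)%E) ->
  density mu P = f %[ae mu].
Proof.
move=> intf PE.
have : ae_eq mu setT (EFin \o density mu P) (EFin \o f).
  apply: integral_ae_eq => //.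
  - exact: integrable_density.
  - exact: measurable_int intf.
  - by move=> A _ mA; rewrite integral_density// PE.
by apply: filterS => x /[apply] /= -[].
Qed.

(** The set where the density is nonpositive has mass at most 0 for [P], hence
    is null for [mu]. *)
Lemma density_gt0 : mu `<< P -> {ae mu, forall x, 0 < density mu P x}.
Proof.
move=> /null_content_dominatesP muP.
pose A := density mu P @^-1` `]-oo, 0]%classic.
have mA : measurable A.
  by rewrite -[A]setTI; exact: measurable_density.
exists A; split=> //.
  apply: muP => //; apply/eqP.
  change (P A == 0%E).
  rewrite eq_le measure_ge0 andbT -(integral_density mA).
  rewrite -[leRHS](integral0 mu A); apply: le_integral => //.
  - by apply: (integrableS measurableT mA _ integrable_density).
  - exact: integrable0.
  - by move=> x; rewrite inE /A /= in_itv/= lee_fin.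
by move=> x /= /negP; rewrite -leNgt /A /= in_itv.
Qed.

End AbsolutelyContinuous.

End Densities.

Section Chart.
Context d (T : measurableType d) (R : realType) (mu : probability T R).
Context (lambda : R) (lambda2 : 2 <= lambda).
Local Notation fmeasure := {finite_measure set T -> \bar R}.
Local Notation Lfun_ := (scaled_Lfun mu lambda).
Local Notation X := (model_space mu lambda2).
Implicit Types (P Q : fmeasure).

Let lambda_ge1 : 1 <= lambda.
Proof. by rewrite (le_trans _ lambda2)// ler1n. Qed.

Let lambda_gt0 : 0 < lambda. Proof. exact: lt_le_trans ltr01 _. Qed.

Let one_le : 0 < (1 : R) <= lambda. Proof. by rewrite ltr01. Qed.

Lemma finite_moment_Lfun (f : T -> R) : measurable_fun setT f ->
  (\int[mu]_x (`|f x| `^ lambda)%:E < +oo)%E <-> Lfun_ 1 f.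
Proof.
move=> mf; rewrite (_ : (\int[mu]_x _)%E =
    ('N[mu]_(lambda / 1)%:E[EFin \o f] `^ lambda)%E); last first.
  by rewrite divr1 poweR_Lnorm ?gt_eqF.
split=> [fy|/scaled_LfunP[_ fy]]; last exact: poweR_lty.
by apply/scaled_LfunP; split => //; apply: lty_poweRy fy; rewrite gt_eqF.
Qed.

Lemma measurable_psi : measurable_fun [set: R] (@psi R).
Proof. exact: is_derive_measurable (@is_derive_psi R). Qed.

Lemma integral_density_powR P : P `<< mu -> mu `<< P ->
  (\int[mu]_x (density mu P x `^ lambda)%:E =
   \int[mu]_x (`|density mu P x| `^ lambda)%:E)%E.
Proof.
move=> Pmu muP; have mp := measurable_density Pmu.
have ae_abs : (fun x => (density mu P x `^ lambda)%:E) =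
    (fun x => (`|density mu P x| `^ lambda)%:E) %[ae mu].
  by apply: filterS (density_gt0 Pmu muP) => x p0 _; rewrite gtr0_norm.
apply: ge0_ae_eq_integral => //.
- exact/measurable_EFinP/(measurableT_comp (measurable_powR _)).
- apply/measurable_EFinP/(measurableT_comp (measurable_powR _)).
  exact: measurableT_comp.
- by move=> x _; rewrite lee_fin powR_ge0.
Qed.

Lemma chart_fun_Lfun P : manifold mu lambda P -> Lfun_ 1 (chart_fun mu P).
Proof.
move=> [Pmu muP iP ilnP]; have mp := measurable_density Pmu.
have mln : measurable_fun setT (fun x => ln (density mu P x)).
  exact: measurableT_comp.
have Lln := (finite_moment_Lfun mln).1 ilnP.
have Lp : Lfun_ 1 (density mu P).
  by apply/(finite_moment_Lfun mp); rewrite -integral_density_powR.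
have L1 := scaled_Lfun_cst mu lambda 1 1.
exact: (scaled_LfunD one_le (scaled_LfunB one_le Lp L1) Lln).1.
Qed.

Lemma density_chart_fun P : manifold mu lambda P ->
  density mu P = (fun x => psi (chart_fun mu P x)) %[ae mu].
Proof.
move=> [Pmu muP _ _]; apply: filterS (density_gt0 Pmu muP) => x p0 _.
by rewrite /chart_fun psi_eq.
Qed.

Lemma chart_repr P : Lfun_ 1 (chart_fun mu P) ->
  model_repr (chart mu lambda2 P) = chart_fun mu P %[ae mu].
Proof.
move=> Lp.
pose F : LfunType mu (exponent_ge1 lambda2) := insubd 0 (chart_fun mu P).
have FE : (F : T -> R) = chart_fun mu P.
  rewrite -[LHS]/(val F) val_insubd ifT//.
  by move: Lp; rewrite /scaled_Lfun divr1.
by rewrite -FE; exact: Lclass_ae.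
Qed.

Lemma psi_Lfun a : Lfun_ 1 a -> Lfun_ 1 (fun x => psi (a x)).
Proof.
move=> La; have ma := measurable_scaled_Lfun La.
have [Lna _] := scaled_Lfun_normr lambda_ge1 ltr01 La.
have [L _] := scaled_LfunD one_le (scaled_Lfun_cst mu lambda 1 1) Lna.
apply: (le_scaled_norm lambda_ge1 ltr01 L _ _).1 => [|x].
  exact: (measurableT_comp measurable_psi).
by rewrite gtr0_norm ?psi_gt0// [leRHS]ger0_norm ?addr_ge0// psi_le.
Qed.

Lemma ell_Lfun a : Lfun_ 1 a -> Lfun_ 1 (fun x => ell (a x)).
Proof.
move=> La; have L1 := scaled_Lfun_cst mu lambda 1 1.
have := scaled_LfunB one_le (scaled_LfunD one_le La L1).1 (psi_Lfun La).
by congr scaled_Lfun; apply/funext => x /=; rewrite -{1}(psi_ell (a x)); ring.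
Qed.

Lemma integrable_psi a : Lfun_ 1 a ->
  mu.-integrable setT (EFin \o (fun x => psi (a x))).
Proof.
move=> La; apply/(scaled_Lfun_integrable mu lambda_ge1).
by apply: (scaled_Lfun_sub lambda_ge1 ltr01) => //; exact: psi_Lfun.
Qed.

(** The measure of density [psi a] with respect to [mu] is the preimage of
    [a]. *)
Lemma chart_surj (a : X) : exists2 P, manifold mu lambda P &
  chart mu lambda2 P = a.
Proof.
pose f := model_repr a; have La : Lfun_ 1 f := scaled_Lfun_repr a.
have intf := integrable_psi La.
have [P PE] := exists_weighted_measure (fun x => ltW (psi_gt0 (f x))) intf.
have mpsi (A : set T) : measurable_fun A (fun x => (psi (f x))%:E).
  exact: measurable_funTS (measurable_int _ intf).
have Pmu : P `<< mu.
  apply/null_content_dominatesP => A mA A0; rewrite PE.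
  exact: null_set_integral.
have muP : mu `<< P.
  apply/null_content_dominatesP => A mA PA0.
  have : (\int[mu]_(x in A) `|(psi (f x))%:E| = 0)%E.
    rewrite -[RHS]PA0 [RHS]PE; apply: eq_integral => x _.
    by rewrite gee0_abs// lee_fin ltW// psi_gt0.
  move=> /(ae_eq_integral_abs mu mA (mpsi A))[N [mN N0 AN]].
  apply: (subset_measure0 mA mN _ N0) => x Ax; apply: AN => /= /(_ Ax)[] /eqP.
  by rewrite gt_eqF// psi_gt0.
have pE : density mu P = (fun x => psi (f x)) %[ae mu].
  by apply: density_unique => // A _; rewrite PE.
have mp := measurable_density Pmu.
have mln : measurable_fun setT (fun x => ln (density mu P x)).
  exact: measurableT_comp.
have Lp : Lfun_ 1 (density mu P).
  exact: scaled_Lfun_ae ltr01 mp pE (psi_Lfun La).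
have Lln : Lfun_ 1 (fun x => ln (density mu P x)).
  apply: scaled_Lfun_ae (ltr01) mln _ (ell_Lfun La) => //.
  by apply: filterS pE => x /[apply] ->; rewrite ln_psi.
have mP : manifold mu lambda P.
  split=> //; last exact/(finite_moment_Lfun mln).
  apply: le_lt_trans ((finite_moment_Lfun mp).2 Lp).
  rewrite le_eqVlt; apply/orP; left; apply/eqP.
  exact: integral_density_powR.
have fE : chart_fun mu P = f %[ae mu].
  apply: filterS pE => x /[apply] px.
  by rewrite /chart_fun px ln_psi psi_ell.
exists P => //; apply: Lspace_eq.
exact: ae_eq_trans (chart_repr (chart_fun_Lfun mP)) fE.
Qed.

(** Surjectivity of the chart is enough: whatever preimage of [a] is chosen,
    its density p solves p - 1 + ln p = a almost everywhere, and this scalar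
    equation has a single solution. *)
Lemma chart_invP (a : X) : manifold mu lambda (chart_inv a) /\
  density mu (chart_inv a) =
    (fun x => psi (model_repr a x)) %[ae mu].
Proof.
have [P0 mP0 cP0] := chart_surj a.
have im : a \in chart mu lambda2 @` manifold mu lambda.
  by rewrite inE; exists P0.
have chK : chart mu lambda2 (chart_inv a) = a by exact: pinvK.
have mP : manifold mu lambda (chart_inv a).
  have ss : set_surj (manifold mu lambda) [set: X] (chart mu lambda2).
    by move=> b _; have [P ? ?] := chart_surj b; exists P.
  by apply: (surjpinv_image_sub ss); exists a.
split=> //; apply: ae_eq_trans (density_chart_fun mP) _.
have := chart_repr (chart_fun_Lfun mP); rewrite chK.
by apply: filterS => x /[apply] ->.
Qed.

End Chart.

(** * The alpha-divergences *)

Section SeparableFamily.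
Context {R : realType}.
Variables (h : R) (H : R -> R) (k : R) (K : R -> R) (c : R) (A B : R -> R).

(** The derivatives of h H(x) + k K(y) + c A(x) B(y). *)
Definition separable_family (i j : nat) (x y : R) : R :=
  h * (derive1n i H x * (j == 0%N)%:R) +
  k * ((i == 0%N)%:R * derive1n j K y) +
  c * (derive1n i A x * derive1n j B y).

Hypotheses (sH : symbol_class 2 H) (sK : symbol_class 2 K).
Hypotheses (sA : symbol_class 1 A) (sB : symbol_class 1 B).

Let is_derive_affine (F G : R -> R) (u v a1 a2 a3 z : R) :
  is_derive z 1 F u -> is_derive z 1 G v ->
  is_derive z 1 (fun z => a1 * F z + a2 + a3 * G z) (a1 * u + a3 * v).
Proof.
move=> Fu Gv.
have D := is_deriveD (is_deriveD (is_deriveZ a1 Fu) (is_derive_cst (a2 : R) z 1))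
  (is_deriveZ a3 Gv).
by apply: (is_derive_eq D); rewrite addr0.
Qed.

Let term_growth (Z : R) (a b : R) (n m : nat) : 1 <= Z -> 0 <= a -> (n <= m)%N ->
  b <= a * Z ^+ n -> b <= a * Z ^+ m.
Proof.
move=> Z1 a0 nm ab; rewrite (le_trans ab)// ler_wpM2l//.
exact: ler_weXn2l.
Qed.

(** A term depending on one variable survives only when the other one is not
    differentiated, which leaves room for quadratic growth; in the product
    each factor has linear growth until it is differentiated. *)
Lemma separable_symbol_family : symbol_family separable_family.
Proof.
split.
- move=> i j y x; have [dH _] := sH i; have [dA _] := sA i.
  rewrite (_ : separable_family i j ^~ y = (fun x =>
      (h * (j == 0%N)%:R) * derive1n i H x +
      k * ((i == 0%N)%:R * derive1n j K y) +
      (c * derive1n j B y) * derive1n i A x)); last first.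
    by apply/funext => z; rewrite /separable_family; ring.
  apply: (is_derive_eq (is_derive_affine _ _ _ (dH x) (dA x))).
  by rewrite /separable_family /=; ring.
- move=> i j x y; have [dK _] := sK j; have [dB _] := sB j.
  rewrite (_ : separable_family i j x = (fun y =>
      (k * (i == 0%N)%:R) * derive1n j K y +
      h * (derive1n i H x * (j == 0%N)%:R) +
      (c * derive1n i A x) * derive1n j B y)); last first.
    by apply/funext => z; rewrite /separable_family; ring.
  apply: (is_derive_eq (is_derive_affine _ _ _ (dK y) (dB y))).
  by rewrite /separable_family /=; ring.
- move=> i j.
  have [_ [CH CH0 hH]] := sH i; have [_ [CK CK0 hK]] := sK j.
  have [_ [CA CA0 hA]] := sA i; have [_ [CB CB0 hB]] := sB j.
  exists (`|h| * CH + `|k| * CK + `|c| * (CA * CB) + 1) => [|x y].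
    by rewrite ltr_wpDl// !addr_ge0// !mulr_ge0.
  set Z := 1 + _ + _; set m := family_order i j.
  have x0 := normr_ge0 x; have y0 := normr_ge0 y.
  have Z1 : 1 <= Z by rewrite /Z; lra.
  have xZ : 1 + `|x| <= Z by rewrite /Z; lra.
  have yZ : 1 + `|y| <= Z by rewrite /Z; lra.
  have powZ n z : 0 <= z -> 1 + z <= Z -> (1 + z) ^+ n <= Z ^+ n.
    by move=> z0 zZ;
      rewrite lerXn2r// nnegrE ?addr_ge0// (le_trans _ zZ) ?addr_ge0.
  have t1 : `|derive1n i H x * (j == 0%N)%:R| <= CH * Z ^+ m.
    case: eqP => [j0|_]; last first.
      by rewrite mulr0 normr0 mulr_ge0// exprn_ge0// (le_trans ler01).
    rewrite mulr1; apply: (@term_growth Z CH _ (2 - i)) => //.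
      by rewrite /m /family_order j0; case: (i) => [|[|n]].
    by rewrite (le_trans (hH x))// ler_wpM2l// powZ.
  have t2 : `|(i == 0%N)%:R * derive1n j K y| <= CK * Z ^+ m.
    case: eqP => [i0|_]; last first.
      by rewrite mul0r normr0 mulr_ge0// exprn_ge0// (le_trans ler01).
    rewrite mul1r; apply: (@term_growth Z CK _ (2 - j)) => //.
      by rewrite /m /family_order i0; case: (j) => [|[|n]].
    by rewrite (le_trans (hK y))// ler_wpM2l// powZ.
  have t3 : `|derive1n i A x * derive1n j B y| <= CA * CB * Z ^+ m.
    have -> : m = ((1 - i) + (1 - j))%N.
      by rewrite /m /family_order; case: (i) => [|n]; case: (j) => [|n'].
    rewrite exprD normrM mulrACA ler_pM//.
      by rewrite (le_trans (hA x))// ler_wpM2l// powZ.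
    by rewrite (le_trans (hB y))// ler_wpM2l// powZ.
  have Zm : 0 <= Z ^+ m by rewrite exprn_ge0// (le_trans ler01).
  rewrite mulrDl mul1r -[leLHS]addr0 lerD// !mulrDl /separable_family.
  rewrite (le_trans (ler_normD _ _))// lerD//.
    rewrite (le_trans (ler_normD _ _))// !normrM lerD//.
      by rewrite -mulrA ler_wpM2l// -normrM.
    by rewrite -mulrA ler_wpM2l// -normrM.
  by rewrite normrM -mulrA ler_wpM2l.
- move=> d T i j a b ma mb.
  have m1 r (f : R -> R) n (u : T -> R) : symbol_class r f ->
      measurable_fun setT u -> measurable_fun setT (fun w => derive1n n f (u w)).
    move=> /(_ n)[df _] mu_; apply: (measurableT_comp _ mu_).
    exact: is_derive_measurable df.
  apply: measurable_funD; first apply: measurable_funD.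
  + apply: measurable_funM => //; apply: measurable_funM => //; exact: m1 sH ma.
  + apply: measurable_funM => //; apply: measurable_funM => //; exact: m1 sK mb.
  + by apply: measurable_funM => //; apply: measurable_funM;
      [exact: m1 sA ma|exact: m1 sB mb].
Qed.

End SeparableFamily.

Section Divergence.
Context {R : realType}.
Implicit Types (x y alpha : R).

Lemma symbol_classW (r n : nat) (f : R -> R) : (r <= n)%N ->
  symbol_class r f -> symbol_class n f.
Proof.
move=> rn sf k; have [df [C C0 fC]] := sf k; split=> //; exists C => // x.
rewrite (le_trans (fC x))// ler_wpM2l// ler_weXn2l ?leq_sub2r//.
by rewrite lerDl.
Qed.

(** The part of the relative entropy that depends on a single measure,
    p ln p - p. *)
Definition entropy x := psi x * ell x - psi x.

(** The integrand of the divergence in terms of the chart variables. The masses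
    of the two measures are included, which makes it pointwise nonnegative. *)
Definition divergence_family alpha : nat -> nat -> R -> R -> R :=
  if alpha == -1 then separable_family 1 entropy 1 psi (-1) psi ell
  else if alpha == 1 then separable_family 1 psi 1 entropy (-1) ell psi
  else separable_family (2 / (1 + alpha)) psi (2 / (1 - alpha)) psi
    (- (4 / (1 - alpha ^+ 2)))
    (psipow ((1 - alpha) / 2)) (psipow ((1 + alpha) / 2)).

Lemma divergence_symbol_family alpha : -1 <= alpha <= 1 ->
  symbol_family (divergence_family alpha).
Proof.
move=> /andP[a1 a2]; have psi2 := symbol_classW (isT : 1 <= 2)%N (@psi_symbol R).
have s01 : 0 <= (1 - alpha) / 2 <= 1 by apply/andP; split; lra.
have t01 : 0 <= (1 + alpha) / 2 <= 1 by apply/andP; split; lra.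
rewrite /divergence_family; case: eqP => _; last case: eqP => _.
- exact: (separable_symbol_family _ _ _ (@entropy_symbol R) psi2
    (@psi_symbol R) (@ell_symbol R)).
- exact: (separable_symbol_family _ _ _ psi2 (@entropy_symbol R)
    (@ell_symbol R) (@psi_symbol R)).
- exact: (separable_symbol_family _ _ _ psi2 psi2
    (psipow_symbol s01) (psipow_symbol t01)).
Qed.

(** The inequality 1 + t <= exp t at t = ell y - ell x, times psi x. *)
Let relative_entropy_ge0 x y : 0 <= psi y - psi x + psi x * (ell x - ell y).
Proof.
have px := psi_gt0 x.
have : psi x * (1 + (ell y - ell x)) <= psi y.
  by rewrite -[leRHS](mulfVK (lt0r_neq0 px)) mulrC ler_pM2r// -expRB expR_ge1Dx.
by lra.
Qed.

Lemma divergence_family_ge0 alpha x y : -1 <= alpha <= 1 ->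
  0 <= divergence_family alpha 0 0 x y.
Proof.
move=> /andP[a1 a2]; rewrite /divergence_family; case: eqP => [_|/eqP an1].
  rewrite /separable_family /= /entropy.
  by have := relative_entropy_ge0 x y; lra.
case: eqP => [_|/eqP an2].
  rewrite /separable_family /= /entropy.
  by have := relative_entropy_ge0 y x; lra.
have {}a1 : -1 < alpha by rewrite lt_neqAle eq_sym an1.
have {}a2 : alpha < 1 by rewrite lt_neqAle an2.
have n1 : 1 + alpha != 0 by rewrite gt_eqF//; lra.
have n2 : 1 - alpha != 0 by rewrite gt_eqF//; lra.
have n3 : 1 - alpha ^+ 2 != 0 by rewrite gt_eqF//; nra.
pose s := (1 - alpha) / 2; pose t := (1 + alpha) / 2.
have s0 : 0 < s by rewrite /s; lra.
have t0 : 0 < t by rewrite /t; lra.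
have st1 : s + t = 1 by rewrite /s /t; field.
have psipowV u v : 0 < u -> psipow u v `^ u^-1 = psi v.
  move=> u0; rewrite /psipow -powRrM mulfV ?gt_eqF//.
  by rewrite powRr1// ltW// psi_gt0.
(* Young's inequality with exponents 1 / s and 1 / t. *)
have young : psipow s x * psipow t y <= s * psi x + t * psi y.
  have := @conjugate_powR R (psipow s x) (psipow t y) s^-1 t^-1 (powR_ge0 _ _)
    (powR_ge0 _ _).
  rewrite !invr_gt0 !invrK => /(_ s0 t0 st1); rewrite !psipowV//.
  by rewrite [s * _]mulrC [t * _]mulrC.
rewrite /separable_family /= -/s -/t !mulr1 !mul1r.
rewrite (_ : _ + _ = (s * t)^-1 *
  (s * psi x + t * psi y - psipow s x * psipow t y)); last first.
  move: (psipow s x) (psipow t y) (psi x) (psi y) => S S' X Y.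
  by rewrite /s /t; field; rewrite n1 n2 n3.
by rewrite mulr_ge0 ?subr_ge0// invr_ge0 mulr_ge0// ltW.
Qed.

End Divergence.

Section DivergenceIntegral.
Context d (T : measurableType d) (R : realType) (mu : probability T R).
Context (lambda : R) (lambda2 : 2 <= lambda).
Local Notation fmeasure := {finite_measure set T -> \bar R}.
Local Notation Lfun_ := (scaled_Lfun mu lambda).
Variables (alpha : R) (P Q : fmeasure) (a b : T -> R).
Hypotheses (alpha_range : -1 <= alpha <= 1) (Pmu : P `<< mu) (Qmu : Q `<< mu).
Hypotheses (La : Lfun_ 1 a) (Lb : Lfun_ 1 b).
Hypothesis pE : density mu P = (fun w => psi (a w)) %[ae mu].
Hypothesis qE : density mu Q = (fun w => psi (b w)) %[ae mu].

Let lambda_ge1 : 1 <= lambda.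
Proof. by rewrite (le_trans _ lambda2)// ler1n. Qed.

Let integral_EFin (f : T -> R) : mu.-integrable setT (EFin \o f) ->
  (\int[mu]_x (f x)%:E = (\int[mu]_x f x)%:E)%E.
Proof. by move=> fi; rewrite /Rintegral fineK// integrable_fin_num. Qed.

Let mass (N : fmeasure) (c : T -> R) : N `<< mu -> Lfun_ 1 c ->
  density mu N = (fun w => psi (c w)) %[ae mu] ->
  N setT = (\int[mu]_w psi (c w))%:E.
Proof.
move=> Nmu Lc nE; have ic := integrable_psi lambda2 Lc.
rewrite -integral_EFin// -(integral_density Nmu measurableT).
apply: ae_eq_integral => //.
- exact: measurable_int (integrable_density Nmu).
- exact: measurable_int ic.
- by apply: filterS nE => w /[apply] ->.
Qed.

Let admissible00 : admissible lambda 0 0.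
Proof.
by split; rewrite ?addn0//= (lt_le_trans _ lambda2)// ltr0n.
Qed.

Let z w := divergence_family alpha 0 0 (a w) (b w).

Lemma divergence_family_integrable : mu.-integrable setT (EFin \o z).
Proof.
apply/(scaled_Lfun_integrable mu lambda_ge1).
have := symbol_family_Lfun lambda2 (divergence_symbol_family alpha_range)
  admissible00 La Lb.
by rewrite !subr0.
Qed.

(** The integral in the definition of the divergence is recovered from the
    integrals of [z] and of the two densities, all known to be finite: this
    avoids a separate integrability proof for each range of [alpha]. *)
Lemma divergenceE : divergence mu alpha P Q = (\int[mu]_w z w)%:E.
Proof.
have iz := divergence_family_integrable.
have ia := integrable_psi lambda2 La; have ib := integrable_psi lambda2 Lb.
have mp := measurable_density Pmu; have mq := measurable_density Qmu.
rewrite /divergence (mass Pmu La pE) (mass Qmu Lb qE).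
have mln (u v : T -> R) : measurable_fun setT u -> measurable_fun setT v ->
    measurable_fun setT (fun w => (u w * ln (u w / v w))%:E : \bar R).
  move=> mu_ mv; apply/measurable_EFinP; apply: measurable_funM => //.
  apply: (measurableT_comp (@measurable_ln R)); apply: measurable_funM => //.
  exact: (measurableT_comp (@measurable_fun_inv R)).
have entE (u v p q : T -> R) (r : T -> R) :
    measurable_fun setT p -> measurable_fun setT q ->
    p = (fun w => psi (u w)) %[ae mu] -> q = (fun w => psi (v w)) %[ae mu] ->
    mu.-integrable setT (EFin \o r) ->
    (forall w, r w = psi (u w) * (ell (u w) - ell (v w))) ->
    (\int[mu]_w (p w * ln (p w / q w))%:E = (\int[mu]_w r w)%:E)%E.
  move=> mp' mq' pu qv ir rE; rewrite -integral_EFin//.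
  apply: ae_eq_integral => //; first exact: mln.
    exact: measurable_int ir.
  move: pu qv; apply: filterS2 => w /(_ I) -> /(_ I) -> _.
  by rewrite rE ln_div ?ln_psi// posrE psi_gt0.
have iab := integrableB measurableT ia ib.
have zE w : z w = divergence_family alpha 0 0 (a w) (b w) by [].
rewrite /divergence_family in zE.
case: ifPn zE => [_|an1].
  rewrite /separable_family /= /entropy => zE.
  rewrite (entE a b _ _ (fun w => z w + (psi (a w) - psi (b w))) mp mq)//.
  - rewrite RintegralD// RintegralB// -!EFinD; congr EFin; ring.
  - exact: (integrableD measurableT iz iab).
  - by move=> w; rewrite zE; ring.
case: ifPn => [_|an2].
  rewrite /separable_family /= /entropy => zE.
  rewrite (entE b a _ _ (fun w => z w - (psi (a w) - psi (b w))) mq mp)//.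
  - rewrite !RintegralB// -!EFinD; congr EFin; ring.
  - exact: (integrableB measurableT iz iab).
  - by move=> w; rewrite zE; ring.
set h := 2 / (1 + alpha); set k := 2 / (1 - alpha).
set c := 4 / (1 - alpha ^+ 2).
rewrite /separable_family /= => zE.
have c0 : c != 0.
  move: alpha_range => /andP[a1 a2].
  have {}a1 : -1 < alpha by rewrite lt_neqAle eq_sym an1.
  have {}a2 : alpha < 1 by rewrite lt_neqAle an2.
  by rewrite /c gt_eqF// divr_gt0//; nra.
have iha := integrableZl measurableT h ia.
have ikb := integrableZl measurableT k ib.
pose r w := c^-1 * (h * psi (a w) + k * psi (b w) - z w).
have ir : mu.-integrable setT (EFin \o r).
  exact: (integrableZl measurableT c^-1
    (integrableB measurableT (integrableD measurableT iha ikb) iz)).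
have rE w : r w =
    psipow ((1 - alpha) / 2) (a w) * psipow ((1 + alpha) / 2) (b w).
  rewrite /r zE mulr1 mul1r opprD addrA subrr add0r mulNr opprK.
  by rewrite mulKf.
have -> : (\int[mu]_w (density mu P w `^ ((1 - alpha) / 2) *
    density mu Q w `^ ((1 + alpha) / 2))%:E = (\int[mu]_w r w)%:E)%E.
  rewrite -integral_EFin//; apply: ae_eq_integral => //.
  - apply/measurable_EFinP; apply: measurable_funM;
      exact: (measurableT_comp (measurable_powR _)).
  - exact: measurable_int ir.
  - by move: pE qE; apply: filterS2 => w /(_ I) -> /(_ I) -> _; rewrite rE.
rewrite -!EFinM -!EFinD; congr EFin.
rewrite /r RintegralZl//; last first.
  exact: (integrableB measurableT (integrableD measurableT iha ikb) iz).
rewrite RintegralB//; last exact: (integrableD measurableT iha ikb).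
rewrite RintegralD// !RintegralZl//.
by field; exact: c0.
Qed.

End DivergenceIntegral.

(** If both [i] and [j] are positive the coefficients are bounded and only
    i + j < lambda is needed; if one of them is 0, the other one leaves room for
    the remaining growth because it is at most the floor of lambda minus 1. *)
Lemma admissible_of_floor_ceil (R : realType) (lambda : R) (i j : nat) :
  2 <= lambda -> i%:Z <= Num.floor lambda - 1 -> j%:Z <= Num.floor lambda - 1 ->
  (i + j)%:Z <= Num.ceil lambda - 1 -> admissible lambda i j.
Proof.
move=> lambda2 hi hj hij.
have le_floor n : n%:Z <= Num.floor lambda - 1 -> n.+1%:R <= lambda.
  move=> hn; have : (n.+1)%:Z <= Num.floor lambda by rewrite -addn1 PoszD; lia.
  by rewrite real_floor_ge_int ?num_real// pmulrn.
have ij : (i + j)%:R < lambda.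
  have : (i + j)%:Z < Num.ceil lambda by lia.
  by rewrite ltNge real_ceil_le_int ?num_real// -ltNge pmulrn.
split=> //; move: (le_floor i hi) (le_floor j hj); rewrite /family_order.
case: (i) ij => [|i']; case: (j) => [|j'] ij hi' hj'.
- by apply: le_trans lambda2; rewrite ler_nat.
- by apply: le_trans hj'; rewrite ler_nat.
- by apply: le_trans hi'; rewrite ler_nat /= !addn0.
- by apply: le_trans (ltW ij); rewrite ler_nat.
Qed.

Theorem corollary5p1 (d : measure_display) (T : measurableType d)
    (R : realType) (mu : probability T R) (lambda : R)
    (lambda2 : 2 <= lambda) (alpha : R) (alpha_range : -1 <= alpha <= 1)
    (i j : nat) (hi : i%:Z <= Num.floor lambda - 1)
    (hj : j%:Z <= Num.floor lambda - 1)
    (hij : (i + j)%:Z <= Num.ceil lambda - 1) :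
  (forall P Q, manifold mu lambda P -> manifold mu lambda Q ->
     (0 <= divergence mu alpha P Q < +oo)%E) /\
  manifold_class_C mu lambda2 i j (fun P Q => fine (divergence mu alpha P Q)).
Proof.
split=> [P Q mP mQ|].
  have [Pmu _ _ _] := mP; have [Qmu _ _ _] := mQ.
  rewrite (divergenceE lambda2 alpha_range Pmu Qmu (chart_fun_Lfun lambda2 mP)
    (chart_fun_Lfun lambda2 mQ) (density_chart_fun mP) (density_chart_fun mQ)).
  rewrite ltry andbT lee_fin; apply: Rintegral_ge0 => w _.
  exact: divergence_family_ge0.
rewrite /manifold_class_C.
have -> : (fun ab : model_space mu lambda2 * model_space mu lambda2 =>
    fine (divergence mu alpha (chart_inv ab.1) (chart_inv ab.2))) =
  (fun ab => \int[mu]_w divergence_family alpha 0 0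
    (model_repr ab.1 w) (model_repr ab.2 w)).
  apply/funext => -[a b] /=.
  have [[Pmu _ _ _] pE] := chart_invP a; have [[Qmu _ _ _] qE] := chart_invP b.
  by rewrite (divergenceE lambda2 alpha_range Pmu Qmu (scaled_Lfun_repr a)
    (scaled_Lfun_repr b) pE qE).
apply: family_map_class_C; first exact: divergence_symbol_family.
exact: admissible_of_floor_ceil.
Qed.
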